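(* Assume (C1), (C2), (C3) and (C4) from the context. If $k>1$ is odd and $$0\notin\frac{\partial^2G_k}{\partial p_1^2}(\mathcal J\times P_1),$$ then $f_\nu^2$ has a $k^{\mathrm{th}}$-order touch-and-go bifurcation (with respect to the predicate $\mathcal C_R$) at some point $(\nu^*,x^* )\in\mathcal J\times P_1\times P_2\times\{0\}$.
   Context: Notation. For a map $g\colon D\subset X\to X$, a set $U\subset D$ and a predicate $\mathcal C$ on $X$, $\mathrm{Fix}(g,U,\mathcal C)=\{x\in U: g(x)=x \text{ and } \mathcal C(x)\}$. $\mathcal C_R(x)$ is the predicate ''$R(x)=x$''. For $M\subset\mathbb R\times X$ let $M_\nu=\{x:(\nu,x)\in M\}$ and $f_\nu=f(\nu,\cdot)\colon M_\nu\to X$. Sums and products of sets of reals are taken elementwise (Minkowski sense). Definition (touch-and-go). Let $g_\nu$ be a one-parameter family of maps with open domain $N\subset\mathbb R\times X$, $\mathcal C$ a predicate on $X$, $k$ a positive integer. $g_\nu$ has a $k^{\mathrm{th}}$-order touch-and-go bifurcation at $(\nu^*,x^* )\in N$ if there are $V=[\nu_1,\nu_2]\times U'\subset N$ with $(\nu^*,x^* )\in\mathrm{int}\,V$ and functions $x_{fp},x_b\colon[\nu_1,\nu_2]\to\mathrm{int}\,U'$, continuous and smooth in the interior of their domains, such that (1) for $\nu\in[\nu_1,\nu_2]$: $\mathrm{Fix}(g_\nu^p,U',\mathcal C)=\{x_{fp}(\nu)\}$ for $1\le p<k$, and $\mathrm{Fix}(g_\nu^k,U',\mathcal C)=\{x_{fp}(\nu),x_b(\nu)\}$;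 (2) the curves $x_{fp}$ and $x_b$ intersect at exactly one point $x^*=x_{fp}(\nu^* )=x_b(\nu^* )$. Setting. $X$ is a smooth manifold of dimension $2n$, $M\subset\mathbb R\times X$ is open, $f\colon M\to X$ is $\mathcal C^3$, and (C1) whenever $M_\nu\ne\emptyset$, $f_\nu\colon M_\nu\to X$ is a diffeomorphism onto its image. $R\colon X\to X$ is a homeomorphism which is a reversing symmetry for every $f_\nu$: $(R\circ f_\nu)(M_\nu)\subset M_\nu$ and $R^{-1}\circ f_\nu\circ R\circ f_\nu=\mathrm{id}$ on $M_\nu$. $\mathrm{Fix}(R)=\{x:R(x)=x\}$ is an $n$-dimensional submanifold. Fix $k$, a point $(\hat\nu,\hat x)\in M$, an open interval $\mathcal J$ and an open set $U\subset X$ with $(\hat\nu,\hat x)\in\mathcal J\times U$ such that $f_\nu^{2k}$ is defined on $U$ for $\nu\in\mathcal J$. There are local coordinates $(p,q)\in\mathbb R^n\times\mathbb R^n$ in $U$ in which $\mathrm{Fix}(R)\cap U=\{(p,q)\in U:q=0\}$; the same symbols denote coordinates near $f_{\hat\nu}(\hat x)$ in which $\mathrm{Fix}(R)$ is likewise given by $q=0$. Split $p=(p_1,p_2)$, $q=(q_1,q_2)\in\mathbb R\times\mathbb R^{n-1}$; $\pi$ with a subscript denotes projection onto the indicated coordinates. There is a smooth curve $\mathcal J\ni\nu\mapsto x_{fp}(\nu)=(p_1(\nu),p_2(\nu),0)\in U$ such that $\mathrm{Fix}(f_\nu^{2i},U,\mathcal C_R)=\{x_{fp}(\nu)\}$ for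 $\nu\in\mathcal J$ and $i=1,\dots,k-1$. (C2) $P_1$ is a closed interval and $P_2$ a closed set (with $P_1\times P_2\times\{0\}\subset U$) such that $p_1(\nu)\in\mathrm{int}\,P_1$ for $\nu\in\mathcal J$, and the solution set of $\pi_{q_2}(f_\nu^k(p_1,p_2,0))=0$ in $\mathcal J\times P_1\times P_2$ is the graph of a smooth function $p_2=p_2(\nu,p_1)\colon\mathcal J\times P_1\to\mathrm{int}\,P_2$. The bifurcation function is $G_k(\nu,p_1)=\pi_{q_1}(f_\nu^k(p_1,p_2(\nu,p_1),0))$. The curve $x_{fp}$ lies in $P_1\times P_2\times\{0\}$, so $G_k(\nu,p_1(\nu))=0$ and $G_k(\nu,p_1)=(p_1-p_1(\nu))\,g_k(\nu,p_1)$ with the reduced bifurcation function $$g_k(\nu,p_1)=\int_0^1\frac{\partial G_k}{\partial p_1}\bigl(\nu,t(p_1-p_1(\nu))+p_1(\nu)\bigr)\,dt .$$ (C3) There is a smooth function $P_1\ni p_1\mapsto\nu(p_1)\in\mathcal J$ such that $\{(\nu,p_1)\in\mathcal J\times P_1:g_k(\nu,p_1)=0\}=\{(\nu(p_1),p_1):p_1\in P_1\}$. (C4) $0\notin\frac{\partial^2G_k}{\partial\nu\partial p_1}(\mathcal J\times P_1)+\frac{\partial^2G_k}{\partial p_1^2}(\mathcal J\times P_1)\,p_1'(\mathcal J)$. *)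

(* Defs.v *)
From HB Require Import structures.
From mathcomp Require Import all_boot all_order all_algebra.
From mathcomp Require Import all_classical all_reals all_analysis.

Set Implicit Arguments.
Unset Strict Implicit.
Unset Printing Implicit Defensive.

Import Order.TTheory GRing.Theory Num.Theory.
Import numFieldNormedType.Exports.

Local Open Scope classical_set_scope.
Local Open Scope ring_scope.

Section Differentiability.
Variable R : realType.

(* Meant for finite-dimensional V, where continuity (resp. C^j regularity) of
   x |-> 'd h x is the same as that of x |-> 'd h x v for every v. *)
Fixpoint Ck (V W : normedModType R) (j : nat) (A : set V) (h : V -> W) : Prop :=
  match j with
  | 0 => forall x, A x -> {for x, continuous h}
  | j'.+1 => (forall x, A x -> differentiable h x) /\
             (forall v : V, Ck j' A (fun x => 'd h x v))
  end.

(* [Some r] is the class C^r and [None] is C^infinity. *)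
Definition Cr (V W : normedModType R) (r : option nat) (A : set V)
    (h : V -> W) : Prop :=
  forall j : nat, (if r is Some m then (j <= m)%N else true) -> Ck j A h.

(* C^r regularity on a set that need not be open: h extends, locally around
   each point of A, to a C^r function on an open set. *)
Definition Cr_on (V W : normedModType R) (r : option nat) (A : set V)
    (h : V -> W) : Prop :=
  forall x, A x -> exists (O : set V) (h' : V -> W),
    [/\ open O, O x, Cr r O h' & forall y, O y -> A y -> h' y = h y].

(* The derivative of h at x relative to A: two-sided in the interior of an
   interval A and one-sided at its endpoints. *)
Definition derive_within (A : set R) (h : R -> R) (x : R) : R :=
  lim ((fun y => (h y - h x) / (y - x)) @ within A x^').

End Differentiability.

Section Manifolds.
Variable R : realType.

(* Only the values of [cfun] on [cdom], and of [cinv] on the image of [cdom],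
   are meaningful. *)
Record chart (X : topologicalType) (E : normedModType R) := Chart {
  cdom : set X;
  cfun : X -> E;
  cinv : E -> X }.

Definition is_chart (X : topologicalType) (E : normedModType R)
    (c : chart X E) : Prop :=
  [/\ open (cdom c),
      open (cfun c @` cdom c),
      forall x, cdom c x -> cinv c (cfun c x) = x,
      forall x, cdom c x -> {for x, continuous (cfun c)} &
      forall z, (cfun c @` cdom c) z -> {for z, continuous (cinv c)}].

Definition smooth_transition (X : topologicalType) (E : normedModType R)
    (c c' : chart X E) : Prop :=
  Cr None (cfun c @` (cdom c `&` cdom c')) (cfun c' \o cinv c).

Definition is_smooth_manifold (X : topologicalType) (E : normedModType R)
    (A : set (chart X E)) : Prop :=
  [/\ hausdorff_space X,
      @second_countable X,
      forall c, A c -> is_chart c,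
      forall x : X, exists2 c, A c & cdom c x &
      forall c c', A c -> A c' -> smooth_transition c c'].

(* Membership in the maximal atlas determined by A. *)
Definition smooth_chart (X : topologicalType) (E : normedModType R)
    (A : set (chart X E)) (c : chart X E) : Prop :=
  is_chart c /\
  forall c', A c' -> smooth_transition c c' /\ smooth_transition c' c.

Definition id_atlas (E : normedModType R) : set (chart E E) :=
  [set Chart setT id id].

Definition prod_chart (X Y : topologicalType) (E F : normedModType R)
    (c : chart X E) (d : chart Y F) : chart (X * Y)%type (E * F)%type :=
  Chart (cdom c `*` cdom d)
        (fun z => (cfun c z.1, cfun d z.2))
        (fun z => (cinv c z.1, cinv d z.2)).

Definition prod_atlas (X Y : topologicalType) (E F : normedModType R)
    (A : set (chart X E)) (B : set (chart Y F)) :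
    set (chart (X * Y)%type (E * F)%type) :=
  [set prod_chart c d | c in A & d in B].

(* Meant for an open D. *)
Definition Cr_map (X Y : topologicalType) (E F : normedModType R)
    (A : set (chart X E)) (B : set (chart Y F)) (r : option nat)
    (D : set X) (g : X -> Y) : Prop :=
  forall x, D x -> {for x, continuous g} /\
    forall c d, A c -> B d -> cdom c x -> cdom d (g x) ->
      exists O : set E,
        [/\ open O, O (cfun c x) & Cr r O (cfun d \o g \o cinv c)].

Definition diffeo_onto_image (X Y : topologicalType) (E F : normedModType R)
    (A : set (chart X E)) (B : set (chart Y F)) (r : option nat)
    (D : set X) (g : X -> Y) : Prop :=
  [/\ Cr_map A B r D g,
      open (g @` D) &
      exists h : Y -> X,
        (forall x, D x -> h (g x) = x) /\ Cr_map B A r (g @` D) h].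

Definition slice_chart (X : topologicalType) (E F : normedModType R)
    (S : set X) (c : chart X (E * F)%type) : Prop :=
  forall x, cdom c x -> (S x <-> (cfun c x).2 = 0).

(* S is an embedded submanifold whose dimension is that of E. *)
Definition is_submanifold (X : topologicalType) (E F : normedModType R)
    (A : set (chart X (E * F)%type)) (S : set X) : Prop :=
  forall x, S x -> exists c, [/\ smooth_chart A c, cdom c x & slice_chart S c].

End Manifolds.

(* A partially defined family is a domain M in R * X together with a total
   function whose values off M are irrelevant. *)
Section Dynamics.
Variables (R : realType) (X : topologicalType).

Definition slice_at (M : set (R * X)) (nu : R) : set X := [set x | M (nu, x)].

Definition iter_dom (M : set (R * X)) (f : R -> X -> X) (j : nat) :
    set (R * X) :=
  [set z | forall i, (i < j)%N -> M (z.1, iter i (f z.1) z.2)].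

Definition Fix_set (g : X -> X) (U : set X) (C : X -> Prop) : set X :=
  [set x | [/\ U x, g x = x & C x]].

(* r is the class meant by smooth. The two curves are compared as graphs over
   the parameter. *)
Definition touch_and_go (E : normedModType R) (A : set (chart X E))
    (r : option nat) (N : set (R * X)) (g : R -> X -> X) (C : X -> Prop)
    (k : nat) (nus : R) (xs : X) : Prop :=
  [/\ open N, N (nus, xs) &
  exists (nu1 nu2 : R) (U' : set X) (xfp xb : R -> X),
    let I := `[nu1, nu2]%classic in
    let V := I `*` U' in
    [/\ [/\ V `<=` N, (V°) (nus, xs) & V `<=` iter_dom N g k],
        [/\ (forall nu, I nu -> (U'°) (xfp nu)), {within I, continuous xfp} &
            Cr_map (id_atlas (E := R)) A r `]nu1, nu2[ xfp],
        [/\ (forall nu, I nu -> (U'°) (xb nu)), {within I, continuous xb} &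
            Cr_map (id_atlas (E := R)) A r `]nu1, nu2[ xb],
        (forall nu, I nu ->
           (forall p, (1 <= p < k)%N ->
              Fix_set (iter p (g nu)) U' C = [set xfp nu]) /\
           Fix_set (iter k (g nu)) U' C = [set xfp nu; xb nu]) &
        [/\ xfp nus = xs, xb nus = xs &
            forall nu, I nu -> xfp nu = xb nu -> nu = nus]]].

End Dynamics.

(* The coordinates ((p1, p2), (q1, q2)) on R^n * R^n, with R^n written as
   R * R^(n-1); intended for n > 0. *)
Notation pqspace R n :=
  ((R * 'rV[R]_n.-1) * (R * 'rV[R]_n.-1))%type (only parsing).

Section Bifurcation.
Variables (R : realType) (X : topologicalType) (n : nat).
Variables (cU cW : chart X (pqspace R n)) (f : R -> X -> X) (k : nat).

Definition pt (p1 : R) (p2 : 'rV[R]_n.-1) : (pqspace R n) := ((p1, p2), 0).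

(* The target chart cW is the one around f_nuhat(xhat), which is where the odd
   iterates f^k of the points of interest lie. *)
Definition fk_coord (nu p1 : R) (p2 : 'rV[R]_n.-1) : (pqspace R n) :=
  cfun cW (iter k (f nu) (cinv cU (pt p1 p2))).

Definition bif_fun (p2f : R -> R -> 'rV[R]_n.-1) (nu p1 : R) : R :=
  (fk_coord nu p1 (p2f nu p1)).2.1.

End Bifurcation.

(* P1 is closed, so the p1-derivative is one-sided at its endpoints. *)
Definition dp1 (R : realType) (P1 : set R) (G : R -> R -> R) (nu p1 : R) : R :=
  derive_within P1 (G nu) p1.

Definition dnu (R : realType) (G : R -> R -> R) (nu p1 : R) : R :=
  derive1 (fun nu' => G nu' p1) nu.

Definition red_bif_fun (R : realType) (P1 : set R) (G : R -> R -> R)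
    (p1c : R -> R) (nu p1 : R) : R :=
  \int[lebesgue_measure]_(t in `[0, 1]%classic)
     dp1 P1 G nu (t * (p1 - p1c nu) + p1c nu).

(* Main.v *)
Require Import Defs.
From HB Require Import structures.
From mathcomp Require Import all_boot all_order all_algebra.
From mathcomp Require Import ring lra zify.
From mathcomp Require Import all_classical all_reals all_analysis.
Import Order.TTheory GRing.Theory Num.Theory.
Import numFieldNormedType.Exports.
Local Open Scope classical_set_scope.
Local Open Scope ring_scope.

Set Implicit Arguments.
Unset Strict Implicit.
Unset Printing Implicit Defensive.

(** Write G for the bifurcation function, g for the reduced one, R for the
    reversing symmetry [rho], and S for the curve of symmetric fixed points.

    Reversibility gives f^m R f^m = R, so a point x of Fix(R) satisfies
    f^(2m) x = x exactly when f^m x lies in Fix(R) again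
    ([symmetric_fixed_pointP]). For m = k this reads, in the two adapted charts,
    as the vanishing of the q-coordinates of f^k(p1, p2, 0): by (C2) the
    q2-equation amounts to p2 = p2(nu, p1), and what remains is
    G(nu, p1) = 0. On S the second iterate is the identity, so that for odd k
    f^k agrees with f there and S is part of the zero set of G.

    The rest takes place in the (nu, p1) plane ([planar_touch_and_go]). The
    graph p1 = p1(nu) of S stays in the interior of the strip J x P1 and the
    graph nu = nu(p1) of (C3) runs across it, hence they meet at some (nu0, p0)
    by the intermediate value theorem ([graphs_cross]). Around this point the
    fundamental theorem of calculus gives G = (p1 - p1(nu)) g
    ([reduction_near]), so there the zero set of G is the union of the two
    graphs. At the point itself the gradient of G is zero: its p1-derivative
    equals g(nu0, p0) = 0, and its derivative along the first graph is zero. If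
    the derivative of nu(p1) were zero at p0, differentiating G(nu(p1), p1) = 0
    twice would leave only the second p1-derivative of G, which is nonzero by
    assumption ([derive_branch_neq0]). So nu(p1) has a local inverse beta of the
    same class ([Cr_near_inverse]) and the second branch is p1 = beta(nu).
    Finally the branches can meet only where the p1-derivative of G vanishes
    along the first graph, and the derivative of this function of nu at nu0 is
    the quantity that (C4) keeps away from 0, so nu0 is an isolated zero
    ([isolated_crossing]).

    Smoothness is carried from the charts to the plane and back by a calculus
    of C^r germs. Since C^r is defined through directional derivatives, the
    chain rule needs coordinates in the intermediate space, whence
    [finite_dimensional]. *)

(** * Calculus of C^r maps *)

Section CkCalculus.
Variable R : realType.
Implicit Types U V W : normedModType R.

(** The first-order expansion of h at x is also one of h', and the differential is
    determined by it. *)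
Lemma near_eq_is_diff V W (h h' : V -> W) (x : V) :
  (\forall y \near x, h y = h' y) -> differentiable h x ->
  is_diff x h' ('d h x).
Proof.
move=> hh' dh; have [cd dE] : continuous ('d h x) /\
    h \o shift x = cst (h x) + 'd h x +o_ 0 id by exact/diff_locallyP.
have hx : h x = h' x by exact: nbhs_singleton hh'.
have dE' : h' \o shift x = cst (h' x) + 'd h x +o_ 0 id.
  apply/eqaddoP => e e0; move/eqaddoP : dE => /(_ e e0); apply: filter_app.
  have : \forall y \near 0, h (y + x) = h' (y + x).
    by move: hh'; rewrite (near_shift 0 x) subr0.
  apply: filter_app; near=> y => hy.
  by rewrite !fctE /= hy hx.
have d'E : 'd h' x = 'd h x :> (V -> W) by exact: diff_unique.
by split; [apply/diff_locallyP; rewrite d'E|exact: d'E].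
Unshelve. all: by end_near. Qed.

Lemma Ck_sub V W j (A B : set V) (h : V -> W) :
  B `<=` A -> Ck j A h -> Ck j B h.
Proof.
elim: j h => [|j IH] h BA /=; first by move=> hA x /BA /hA.
by move=> [dh Dh]; split=> [x /BA /dh//|v]; apply: IH.
Qed.

Lemma Ck_pred V W j (A : set V) (h : V -> W) : Ck j.+1 A h -> Ck j A h.
Proof.
elim: j h => [|j IH] h [dh Dh].
  by move=> x Ax; apply: differentiable_continuous; exact: dh.
by split=> // v; apply: IH.
Qed.

Lemma Ck_eq V W j (A : set V) (h h' : V -> W) : open A ->
  (forall x, A x -> h x = h' x) -> Ck j A h -> Ck j A h'.
Proof.
move=> oA; elim: j h h' => [|j IH] h h' hh'.
  move=> hA x Ax; rewrite /prop_for /continuous_at -hh' //.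
  apply: cvg_trans (hA x Ax); apply: near_eq_cvg.
  near=> y; apply: hh'; near: y; exact: open_nbhs_nbhs.
move=> [dh Dh].
have dE x : A x -> is_diff x h' ('d h x).
  move=> Ax; apply: near_eq_is_diff; last exact: dh.
  near=> y; apply: hh'; near: y; exact: open_nbhs_nbhs.
split=> [x Ax|v]; first by have [] := dE x Ax.
apply: (IH (fun x => 'd h x v)) => [x Ax|]; last exact: Dh.
by have [_ ->] := dE x Ax.
Unshelve. all: by end_near. Qed.

Lemma Ck_cst V W j (A : set V) (w : W) : Ck j A (fun=> w).
Proof.
elim: j w => [|j IH] w; first by move=> x _; exact: cst_continuous.
split=> [x _|v]; first exact: differentiable_cst.
rewrite (_ : (fun _ => _) = fun=> 0) //; apply/funext => x.
by rewrite [X in X v](_ : _ = 0 :> (V -> W))// (diff_cst w).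
Qed.

Lemma Ck_linear V W j (A : set V) (l : {linear V -> W}) :
  continuous l -> Ck j A l.
Proof.
move=> cl; case: j => [|j]; first by move=> x _; exact: cl.
split=> [x _|v]; first exact: linear_differentiable.
rewrite (_ : (fun _ => _) = fun=> l v); first exact: Ck_cst.
by apply/funext => x; rewrite diff_lin.
Qed.

Lemma Ck_pair U V W j (A : set U) (g : U -> V) (h : U -> W) : open A ->
  Ck j A g -> Ck j A h -> Ck j A (fun x => (g x, h x)).
Proof.
move=> oA; elim: j g h => [|j IH] g h; first move=> gA hA x Ax.
  by apply: cvg_pair; [exact: gA|exact: hA].
move=> [dg Dg] [dh Dh]; split=> [x Ax|v].
  by apply: differentiable_pair; [exact: dg|exact: dh].
apply: (Ck_eq oA _ (IH _ _ (Dg v) (Dh v))) => // x Ax.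
by rewrite diff_pair//; [exact: dg|exact: dh].
Qed.

Lemma Ck_add V W j (A : set V) (g h : V -> W) : open A ->
  Ck j A g -> Ck j A h -> Ck j A (fun x => g x + h x).
Proof.
move=> oA; elim: j g h => [|j IH] g h; first move=> gA hA x Ax.
  by apply: cvgD; [exact: gA|exact: hA].
move=> [dg Dg] [dh Dh]; split=> [x Ax|v].
  by apply: differentiableD; [exact: dg|exact: dh].
apply: (Ck_eq oA _ (IH _ _ (Dg v) (Dh v))) => // x Ax.
by rewrite diffD//; [exact: dg|exact: dh].
Qed.

Lemma Ck_sum V W j (A : set V) (I : finType) (h : I -> V -> W) : open A ->
  (forall i, Ck j A (h i)) -> Ck j A (fun x => \sum_i h i x).
Proof.
move=> oA hA; rewrite (_ : (fun _ => _) = \sum_i h i); last first.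
  by apply/funext => x; rewrite fct_sumE.
elim/big_rec : _ => [|i g _ gA]; first exact: Ck_cst.
exact: (Ck_add oA (hA i)).
Qed.

(** The product rule is that of the bilinear map (c, w) |-> c *: w. *)
Lemma is_diff_scale V W (a : V -> R) (w : V -> W) x :
  differentiable a x -> differentiable w x ->
  is_diff x (fun y => a y *: w y) (fun v => a x *: 'd w x v + 'd a x v *: w x).
Proof.
move=> da dw.
have sb : bilinear_for (GRing.Scale.Law.clone _ _ *:%R _)
    (GRing.Scale.Law.clone _ _ *:%R _) (@GRing.scale R W : R -> W -> W).
  split=> [u'|u] c y z /=; first by rewrite scalerDl scalerA.
  by rewrite scalerDr !scalerA mulrC.
pose sM := bilinear_isBilinear.Build R R W W _ _ (@GRing.scale R W : R -> W -> W) sb.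
pose s : {bilinear R -> W -> W} := HB.pack (@GRing.scale R W : R -> W -> W) sM.
have sc : continuous (fun p : R * W => s p.1 p.2) by exact: scale_continuous.
have dp : differentiable (fun y => (a y, w y)) x by exact: differentiable_pair.
have ds : differentiable (fun p : R * W => s p.1 p.2) (a x, w x).
  exact: differentiable_bilin.
split; first exact: (differentiable_comp dp ds).
rewrite (_ : (fun y => _) = (fun p : R * W => s p.1 p.2) \o (fun y => (a y, w y))) //.
by rewrite diff_comp// diff_bilin// diff_pair.
Qed.

Lemma Ck_scale V W j (A : set V) (a : V -> R) (w : V -> W) : open A ->
  Ck j A a -> Ck j A w -> Ck j A (fun x => a x *: w x).
Proof.
move=> oA; elim: j a w => [|j IH] a w; first move=> aA wA x Ax.
  by apply: cvgZ; [exact: aA|exact: wA].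
move=> /[dup] /Ck_pred aA [da Da] /[dup] /Ck_pred wA [dw Dw].
split=> [x Ax|v]; first by have [] := is_diff_scale (da x Ax) (dw x Ax).
apply: (Ck_eq oA _ (Ck_add oA (IH _ _ aA (Dw v)) (IH _ _ (Da v) wA))) => x Ax.
by have [_ ->] := is_diff_scale (da x Ax) (dw x Ax).
Qed.

(** Continuity of the coordinate forms is part of the notion, so that no
    comparison of norms is needed. *)
Definition finite_dimensional V := exists (I : finType) (e : I -> V)
  (l : I -> {linear V -> R}),
  (forall i, continuous (l i)) /\ forall v, v = \sum_i l i v *: e i.

Lemma finite_dimensional_scalar : finite_dimensional R.
Proof.
exists 'I_1, (fun=> 1), (fun=> idfun); split=> [_ x|v]; first exact: cvg_id.
by rewrite big_ord1 /= /GRing.scale /= mulr1.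
Qed.

Lemma finite_dimensional_row m : finite_dimensional 'rV[R]_m.
Proof.
pose l (i : 'I_m) (v : 'rV[R]_m) : R := v 0 i.
have ll i : linear (l i) by move=> c u v; rewrite /l !mxE.
pose L i : {linear 'rV[R]_m -> R} := HB.pack (l i)
  (GRing.isLinear.Build _ _ _ _ (l i) (ll i)).
exists 'I_m, (fun i => delta_mx 0 i), L.
split=> [i|v]; first exact: coord_continuous.
exact: row_sum_delta.
Qed.

Lemma finite_dimensional_prod V W : finite_dimensional V ->
  finite_dimensional W -> finite_dimensional (V * W)%type.
Proof.
move=> [I [e [l [cl lE]]]] [J [f [m [cm mE]]]].
exists (I + J)%type, (fun s => match s with inl i => (e i, 0) | inr j => (0, f j) end),
  (fun s => match s with
            | inl i => (l i \o fst : {linear (V * W)%type -> R})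
            | inr j => (m j \o snd : {linear (V * W)%type -> R}) end).
split=> [[i|j]|[v w]].
- by move=> x; apply: continuous_comp; [exact: cvg_fst|exact: cl].
- by move=> x; apply: continuous_comp; [exact: cvg_snd|exact: cm].
rewrite big_sumType /= [RHS]surjective_pairing; congr (_, _).
  rewrite [RHS]/= !(raddf_sum fst) /= [LHS]lE [X in _ + X]big1 ?addr0// => j _.
  by rewrite scaler0.
rewrite [RHS]/= !(raddf_sum snd) /= [LHS]mE [X in X + _]big1 ?add0r// => j _.
by rewrite scaler0.
Qed.

Lemma Ck_linear_comp U V W j (A : set U) (h : U -> V) (l : {linear V -> W}) :
  open A -> continuous l -> Ck j A h -> Ck j A (l \o h).
Proof.
move=> oA cl; elim: j h => [|j IH] h.
  by move=> hA x Ax; apply: continuous_comp; [exact: hA|exact: cl].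
move=> [dh Dh]; split=> [x Ax|v].
  by apply: differentiable_comp; [exact: dh|exact: (linear_differentiable (h x) cl)].
apply: (Ck_eq oA _ (IH _ (Dh v))) => x Ax.
by rewrite (diff_comp (dh x Ax) (linear_differentiable (h x) cl)) /= diff_lin.
Qed.

(** The derivative of g o h in a fixed direction evaluates 'd g in a direction
    that moves with the point; expanding this direction in coordinates writes it
    as a sum of scalar functions times derivatives of g in fixed directions, to
    which the induction hypothesis applies. *)
Lemma Ck_comp U V W j (A : set U) (B : set V) (h : U -> V) (g : V -> W) :
  finite_dimensional V -> open A -> (forall x, A x -> B (h x)) ->
  Ck j A h -> Ck j B g -> Ck j A (g \o h).
Proof.
move=> [I [e [l [cl lE]]]] oA AB; elim: j g h AB => [|j IH] g h AB.
  by move=> hA gB x Ax; apply: continuous_comp; [exact: hA|exact/gB/AB].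
move=> /[dup] /Ck_pred hA [dh Dh] [dg Dg]; split=> [x Ax|v].
  by apply: differentiable_comp; [exact: dh|exact/dg/AB].
apply: (@Ck_eq _ _ _ _
  (fun x => \sum_i l i ('d h x v) *: 'd g (h x) (e i)) _ oA).
  move=> x Ax; have dgx := dg _ (AB _ Ax); rewrite (diff_comp (dh x Ax) dgx) /=.
  rewrite [in RHS](lE ('d h x v)) linear_sum; apply: eq_bigr => i _.
  by rewrite linearZ_LR.
apply: Ck_sum => // i; apply: Ck_scale => //; last first.
  exact: (IH (fun y => 'd g y (e i)) h AB hA (Dg (e i))).
exact: (Ck_linear_comp oA (cl i) (Dh v)).
Qed.

Lemma Ck_inv j : Ck j [set x : R | x != 0] (fun x => x^-1).
Proof.
have oA : open [set x : R | x != 0] by exact: open_neq.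
elim: j => [|j IH]; first by move=> x x0; exact: inv_continuous.
split=> [x x0|v]; first exact: differentiable_Rinv.
apply: (Ck_eq oA _ (Ck_scale oA IH (Ck_scale oA IH (Ck_cst j _ (- v))))) => x x0.
by rewrite diff_Rinv// scalerN scalerN scalerA scaleNr expr2 invfM.
Qed.

Definition Cr_near V W (r : option nat) (z : V) (h : V -> W) : Prop :=
  exists O : set V, [/\ open O, O z & Cr r O h].

Lemma Cr_near_continuous V W r (z : V) (h : V -> W) :
  Cr_near r z h -> {for z, continuous h}.
Proof.
move=> [B [oB Bz hB]]; have h0 : Ck 0 B h by apply: hB; case: (r).
exact: h0.
Qed.

Lemma Cr_near_near V W r (z : V) (h : V -> W) :
  Cr_near r z h -> \forall y \near z, Cr_near r y h.
Proof.
move=> [B [oB Bz hB]]; near=> y; exists B; split=> //.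
by near: y; exact: open_nbhs_nbhs.
Unshelve. all: by end_near. Qed.

Lemma Cr_near_eq V W r (z : V) (h h' : V -> W) :
  (\forall y \near z, h y = h' y) -> Cr_near r z h -> Cr_near r z h'.
Proof.
move=> hh' [B [oB Bz hB]]; exists (B `&` [set y | h y = h' y]°); split=> //.
  by apply: openI => //; exact: open_interior.
move=> j jr; apply: (@Ck_eq _ _ _ _ h).
- by apply: openI => //; exact: open_interior.
- by move=> x [_ /interior_subset].
- by apply: Ck_sub (hB j jr) => x [].
Qed.

Lemma Cr_near_linear V W r (z : V) (l : {linear V -> W}) :
  continuous l -> Cr_near r z l.
Proof.
by move=> cl; exists setT; split=> //; [exact: openT|move=> j _; exact: Ck_linear].
Qed.

Lemma Cr_near_cst V W r (z : V) (w : W) : Cr_near r z (fun=> w).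
Proof. by exists setT; split=> //; [exact: openT|move=> j _; exact: Ck_cst]. Qed.

Lemma Cr_near_fst V W r (z : V * W) : Cr_near r z (@fst V W).
Proof. by apply: (Cr_near_linear r z (l := fst)) => x; exact: cvg_fst. Qed.

Lemma Cr_near_snd V W r (z : V * W) : Cr_near r z (@snd V W).
Proof. by apply: (Cr_near_linear r z (l := snd)) => x; exact: cvg_snd. Qed.

Lemma Cr_near_id V r (z : V) : Cr_near r z id.
Proof. by apply: (Cr_near_linear r z (l := idfun)) => x; exact: cvg_id. Qed.

Lemma Cr_near_pair U V W r (z : U) (g : U -> V) (h : U -> W) :
  Cr_near r z g -> Cr_near r z h -> Cr_near r z (fun x => (g x, h x)).
Proof.
move=> [B [oB Bz gB]] [C [oC Cz hC]]; exists (B `&` C); split=> //.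
  exact: openI.
move=> j jr; apply: Ck_pair; first exact: openI.
  by apply: Ck_sub (gB j jr) => x [].
by apply: Ck_sub (hC j jr) => x [].
Qed.

Lemma Cr_near_comp U V W r (z : U) (h : U -> V) (g : V -> W) :
  finite_dimensional V -> Cr_near r z h -> Cr_near r (h z) g ->
  Cr_near r z (g \o h).
Proof.
move=> fV /[dup] /Cr_near_continuous ch [B [oB Bz hB]] [C [oC Cz gC]].
exists (B `&` (h @^-1` C)°); split.
- by apply: openI => //; exact: open_interior.
- by split=> //; apply: ch; exact: open_nbhs_nbhs.
move=> j jr; apply: (Ck_comp fV (B := C)).
- by apply: openI => //; exact: open_interior.
- by move=> x [_ /interior_subset].
- by apply: Ck_sub (hB j jr) => x [].
- exact: gC.
Qed.

(** The order on smoothness classes, in which [None] is the largest. *)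
Definition class_le (s r : option nat) : Prop := forall j : nat,
  is_true (if s is Some m then (j <= m)%N else true) ->
  is_true (if r is Some m then (j <= m)%N else true).

Lemma Cr_near_le V W r s (z : V) (h : V -> W) :
  class_le s r -> Cr_near r z h -> Cr_near s z h.
Proof.
by move=> sr [B [oB Bz hB]]; exists B; split=> // j /sr; exact: hB.
Qed.

Lemma Cr_near_differentiable V W r (z : V) (h : V -> W) :
  Cr_near (Some r.+1) z h -> differentiable h z.
Proof. by move=> [B [oB Bz hB]]; have [dh _] := hB 1%N erefl; exact: dh. Qed.

Lemma Cr_near_diff V W r (z : V) (h : V -> W) v :
  Cr_near (Some r.+1) z h -> Cr_near (Some r) z (fun x => 'd h x v).
Proof.
move=> [B [oB Bz hB]]; exists B; split=> // j jr.
by have [_] := hB j.+1 jr; exact.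
Qed.

End CkCalculus.

Lemma near_curve (T U V : topologicalType) (f : T -> U) (g : T -> V) (x : T)
    (P : U * V -> Prop) : {for x, continuous f} -> {for x, continuous g} ->
  (\forall z \near (f x, g x), P z) -> \forall y \near x, P (f y, g y).
Proof.
move=> cf cg; have : {for x, continuous (fun y => (f y, g y))} by exact: cvg_pair.
by move=> /[apply].
Qed.

Lemma near_fst (U V : topologicalType) (a : U) (b : V) (P : U -> Prop) :
  (\forall x \near a, P x) -> \forall z \near (a, b), P z.1.
Proof. exact: (@cvg_fst _ _ (nbhs a) (nbhs b)). Qed.

Lemma near_snd (U V : topologicalType) (a : U) (b : V) (P : V -> Prop) :
  (\forall x \near b, P x) -> \forall z \near (a, b), P z.2.
Proof. exact: (@cvg_snd _ _ (nbhs a) (nbhs b)). Qed.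

Lemma near_eq_derive1 (R : realType) (f g : R -> R) x : (\forall y \near x, f y = g y) ->
  derive1 f x = derive1 g x.
Proof. by move=> fg; rewrite !derive1E; exact: near_eq_derive. Qed.

Lemma Cr_on_interior (R : realType) (V W : normedModType R) r (D : set V)
  (h : V -> W) x : D° x -> Cr_on r D h -> Cr_near r x h.
Proof.
move=> Dx hD; have [B [h' [oB Bx hB hE]]] := hD x (interior_subset Dx).
apply: (@Cr_near_eq _ _ _ _ _ h'); last by exists B.
near=> y; apply: hE; last by near: y.
by near: y; exact: open_nbhs_nbhs.
Unshelve. all: by end_near. Qed.

Lemma Cr_on_continuous (R : realType) (V W : normedModType R) r (D : set V)
  (h : V -> W) : Cr_on r D h -> {within D, continuous h}.
Proof.
move=> hD; apply/subspace_continuousP => x Dx.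
have [B [h' [oB Bx hB hE]]] := hD x Dx.
have ch' : {for x, continuous h'} by apply: (@Cr_near_continuous _ _ _ r); exists B.
suff : h @ within D (nbhs x) --> h' x by rewrite (hE x).
have cw : h' @ within D (nbhs x) --> h' x by exact: cvg_within_filter.
apply: cvg_trans cw; apply: near_eq_cvg; rewrite near_withinE; near=> y => Dy.
by rewrite hE//; near: y; exact: open_nbhs_nbhs.
Unshelve. all: by end_near. Qed.

(** * Functions of one real variable *)

Section RealFunctions.
Variable R : realType.
Implicit Types (r : option nat).

Lemma injective_of_derive_neq0 (f : R -> R) (p e : R) :
  (forall x, ball p e x -> derivable f x 1 /\ derive1 f x != 0) ->
  forall x y, ball p e x -> ball p e y -> f x = f y -> x = y.
Proof.
move=> df.
suff H x y : x < y -> ball p e x -> ball p e y -> f x <> f y.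
  move=> x y px py fxy; have [xy|yx|//] := ltgtP x y; first by have := H _ _ xy px py.
  by have := H _ _ yx py px; rewrite fxy.
move=> xy px py fxy.
have xyp z : z \in `[x, y] -> ball p e z.
  rewrite in_itv /= => /andP[xz zy]; move: px py; rewrite /ball /= !ltr_norml.
  move=> /andP[p1 p2] /andP[p3 p4]; apply/andP; split.
    by rewrite (lt_le_trans p3)// lerB.
  by rewrite (le_lt_trans _ p2)// lerB.
have [|z|c cxy] := @MVT R f (derive1 f) x y xy.
- move=> c cxy; have [dc _] := df c (xyp _ (subset_itv_oo_cc cxy)).
  by rewrite derive1E; exact: derivableP.
- move=> z'; apply: derivable_within_continuous => t /xyp /df[].
  by [].
have [_ dc] := df c (xyp _ (subset_itv_oo_cc cxy)).
rewrite fxy subrr => /esym/eqP; rewrite mulf_eq0 (negbTE dc)/= subr_eq0 => /eqP yx.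
by move: xy; rewrite yx ltxx.
Qed.

Lemma Ck_comp1 j (A B : set R) (h g : R -> R) :
  open A -> (forall x, A x -> B (h x)) -> Ck j A h -> Ck j B g -> Ck j A (g \o h).
Proof. exact: Ck_comp (finite_dimensional_scalar R). Qed.

(** The inverse function theorem on the line. Differentiability of the inverse
    comes with g' = 1 / (f' o g), and this formula raises the class of g by one
    as long as f' allows it: C^j for g gives C^j for g', hence C^(j+1) for g. *)
Lemma Cr_near_inverse r (f : R -> R) (p : R) :
  is_true (if r is Some m then (1 <= m)%N else true) ->
  Cr_near r p f -> derive1 f p != 0 ->
  exists g : R -> R, [/\ \forall x \near p, g (f x) = x,
    \forall y \near f p, f (g y) = y & Cr_near r (f p) g].
Proof.
move=> r1 [B [oB Bp fB]] fp0.
have [df0 Df0] : Ck 1 B f by apply: fB; case: (r) r1.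
have [e e0 He] : exists2 e : R, 0 < e &
    forall x, ball p e x -> B x /\ derive1 f x != 0.
  have : \forall x \near p, B x /\ 'd f x 1 != 0.
    apply: filterI; first exact: open_nbhs_nbhs.
    have cD : (fun x => 'd f x 1) x @[x --> p] --> 'd f p 1 := Df0 1 p Bp.
    apply: (cD [set x | x != 0]); apply: open_nbhs_nbhs; split; first exact: open_neq.
    by rewrite /= -derive1E'//; exact: df0.
  move=> /nbhs_ballP[e e0 He]; exists e => // x /He[Bx dx]; split=> //.
  by rewrite derive1E'//; exact: df0.
have df x : ball p e x -> differentiable f x by move=> /He[Bx _]; exact: df0.
have finj : forall x y, ball p e x -> ball p e y -> f x = f y -> x = y.
  apply: injective_of_derive_neq0 => x px; have [_ fx0] := He x px; split=> //.
  exact/derivable1_diffP/df.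
pose g y := xget p [set x | ball p e x /\ f x = y].
have gf x : ball p e x -> g (f x) = x.
  move=> px; rewrite /g; case: xgetP => [z _ [pz fzx]|/(_ x)]; first exact: finj.
  by move=> [].
have near_gf x : ball p e x -> {near x, cancel f g}.
  move=> px; near=> z; apply: gf; near: z; apply: open_nbhs_nbhs; split=> //.
  exact: ball_open.
have near_cf x : ball p e x -> {near x, continuous f}.
  move=> px; near=> z; apply: differentiable_continuous; apply: df.
  by near: z; apply: open_nbhs_nbhs; split=> //; exact: ball_open.
have pp : ball p e p by exact: ballxx.
have fg : \forall y \near f p, f (g y) = y.
  exact: near_continuous_can_sym (near_cf p pp) (near_gf p pp).
have cg : {for f p, continuous g}.
  exact: (nbhs_singleton (near_can_continuous (near_gf p pp) (near_cf p pp))).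
exists g; split=> //; first by near=> x; apply: gf; near: x; exact: nbhsx_ballx.
have [C [oC Cp HC]] : exists C : set R, [/\ open C, C (f p) &
    forall y, C y -> f (g y) = y /\ ball p e (g y)].
  have : \forall y \near f p, f (g y) = y /\ ball p e (g y).
    apply: filterI => //; apply: cg; rewrite gf//; exact: nbhsx_ballx.
  move=> H; exists ([set y | f (g y) = y /\ ball p e (g y)]°); split=> //.
    exact: open_interior.
  by move=> y /interior_subset.
exists C; split=> // j; elim: j => [|j IH] jr.
  move=> y /HC[fy py]; rewrite -fy; have := near_can_continuous (near_gf _ py) (near_cf _ py).
  exact: nbhs_singleton.
have Dg y : C y -> is_derive y 1 g (derive1 f (g y))^-1.
  move=> /HC[fy py]; rewrite -{1}fy.
  apply: is_derive_inverse (near_gf _ py) (near_cf _ py) _ _; last by have [] := He _ py.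
  by rewrite derive1E; apply: derivableP; exact/derivable1_diffP/df.
have dg y : C y -> differentiable g y.
  by move=> /Dg Cy; apply/derivable1_diffP; exact: ex_derive.
split=> // v.
have jr' : is_true (if r is Some m then (j <= m)%N else true).
  by case: (r) jr => // m /ltnW.
have [_ DB] := fB _ jr.
have oB' : open (ball p e) by exact: ball_open.
apply: (@Ck_eq _ _ _ _ _ (fun y =>
    ((fun x : R => x^-1) \o ((fun x => 'd f x 1) \o g)) y *: v)) => //.
  move=> y Cy; have [_ py] := HC y Cy.
  transitivity ((derive1 f (g y))^-1 *: v).
    by congr (_^-1 *: _); exact: (esym (derive1E' (df _ py))).
  have gE : derive1 g y = (derive1 f (g y))^-1.
    by rewrite derive1E; exact: (@derive_val _ _ _ _ _ _ _ (Dg y Cy)).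
  have dE := deriv1E (@ex_derive _ _ _ _ _ _ _ (Dg y Cy)).
  by rewrite [RHS](congr1 (fun u : R -> R => u v) dE) gE /GRing.scale /= mulrC.
apply: Ck_scale => //; last exact: Ck_cst.
apply: (@Ck_comp1 _ C [set x : R | x != 0]) => //.
- move=> y Cy; have [_ py] := HC y Cy; have [Bx] := He _ py.
  by rewrite derive1E'//; exact: df.
- apply: (@Ck_comp1 _ C (ball p e)) => //.
  + by move=> y /HC[].
  + exact: (IH jr').
  + by apply: Ck_sub (DB 1) => x /He[].
- exact: Ck_inv.
Unshelve. all: by end_near. Qed.

(** Near an interior point of P, restricting to P leaves the punctured
    neighbourhoods unchanged. *)
Lemma derive_withinE (P : set R) (F : R -> R) x :
  P° x -> derive_within P F x = derive1 F x.
Proof.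
move=> Px; rewrite /derive_within /derive1; congr (lim _).
rewrite predeqE => Q; split.
  move=> H; have : \forall y \near x, y != x -> Q ((F y - F x) / (y - x)).
    have H' : \forall y \near x, y != x -> P y -> Q ((F y - F x) / (y - x)) by [].
    near=> y => yx; have Py : P y by near: y.
    by move: yx Py; near: y.
  rewrite (near_shift 0 x) subr0 => {}H.
  change (\forall h \near 0, h != 0 -> Q (h^-1 *: (F (h + x) - F x))).
  near=> h => h0; have /= := near H h; rewrite addrK.
  by rewrite mulrC; apply => //; rewrite -subr_eq0 addrK.
move=> H; have {}H : \forall h \near 0, h != 0 -> Q (h^-1 *: (F (h + x) - F x)) by [].
change (\forall y \near x, y != x -> P y -> Q ((F y - F x) / (y - x))).
move: H; rewrite (near_shift x 0) sub0r => H; near=> y => yx _.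
have /= := near H y; rewrite subrK mulrC; apply => //.
by rewrite subr_eq0.
Unshelve. all: by end_near. Qed.

(** The fundamental theorem of calculus for t |-> F (t (p - q) + q), whose
    derivative carries the factor p - q. *)
Lemma integral_derive_segment (P : set R) (F : R -> R) (p q : R) :
  (forall t, t \in `[0, 1] -> P° (t * (p - q) + q) /\
     derivable F (t * (p - q) + q) 1 /\
     {for (t * (p - q) + q), continuous (derive1 F)}) ->
  (p - q) * (\int[lebesgue_measure]_(t in `[0, 1]%classic)
     derive_within P F (t * (p - q) + q)) = F p - F q.
Proof.
move=> H; have [->|pq] := eqVneq p q; first by rewrite !subrr mul0r.
have pq0 : p - q != 0 by rewrite subr_eq0.
pose s (t : R) := t * (p - q) + q.
have ds (t : R) : is_derive t 1 s (p - q).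
  have : is_derive t 1 ((p - q) \*: id + cst q) ((p - q) *: 1 + 0) by exact: is_deriveD.
  rewrite addr0 /GRing.scale /= mulr1.
  rewrite (_ : (p - q) \*: id + cst q = s) //; apply/funext => z.
  by rewrite !fctE /s /GRing.scale /= mulrC.
(* Dividing by p - q makes the integrand the derivative of K itself. *)
pose K (t : R) := F (s t) / (p - q).
have dK (t : R) : t \in `[0, 1] -> is_derive t 1 K (derive1 F (s t)).
  move=> t01; have [_ [dF _]] := H t t01.
  have dFst : is_derive (s t) 1 F (derive1 F (s t)).
    by rewrite derive1E; exact: derivableP.
  have dFs : is_derive t 1 (F \o s) (derive1 F (s t) * (p - q)).
    exact: is_derive1_comp.
  rewrite (_ : K = (p - q)^-1 \*: (F \o s)); last first.
    by apply/funext => z; rewrite /K /= mulrC.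
  apply: is_derive_eq; rewrite /GRing.scale /= mulrC mulfK//.
rewrite (_ : Rintegral _ _ _ =
  \int[lebesgue_measure]_(t in `[0, 1]%classic) derive1 F (s t)); last first.
  apply: eq_Rintegral => t; rewrite inE /= => t01.
  by rewrite derive_withinE//; have [] := H t t01.
have := @continuous_FTC2 R (fun t => derive1 F (s t)) K 0 1 ltr01.
rewrite /Rintegral => -> //=.
- rewrite /K /s mul0r add0r mul1r subrK -mulrBl mulrC divfK//.
- apply: continuous_in_subspaceT => t; rewrite inE /= => t01.
  have [_ [_ cF]] := H t t01.
  apply: (@continuous_comp _ _ _ s (derive1 F)) => //.
  by apply: differentiable_continuous; apply/derivable1_diffP.
- have cK (t : R) : t \in `[0, 1] -> {for t, continuous K}.
    move=> /dK t01; apply: differentiable_continuous; apply/derivable1_diffP.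
    exact: ex_derive.
  split.
  + by move=> t t01; have := dK t (subset_itv_oo_cc t01) => ?; exact: ex_derive.
  + by apply: cvg_at_right_filter; apply: cK; rewrite in_itv /= lexx ler01.
  + by apply: cvg_at_left_filter; apply: cK; rewrite in_itv /= lexx ler01.
- move=> t t01; rewrite derive1E.
  exact: (@derive_val _ _ _ _ _ _ _ (dK t (subset_itv_oo_cc t01))).
Qed.

Lemma diff_along_curve (H : R * R -> R) (a b : R -> R) t :
  differentiable a t -> differentiable b t -> differentiable H (a t, b t) ->
  differentiable (fun s => H (a s, b s)) t /\
  derive1 (fun s => H (a s, b s)) t =
    derive1 a t * 'd H (a t, b t) (1, 0) + derive1 b t * 'd H (a t, b t) (0, 1).
Proof.
move=> da db dH; have dp : differentiable (fun s => (a s, b s)) t by exact: differentiable_pair.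
have dc : differentiable (fun s => H (a s, b s)) t := differentiable_comp dp dH.
split=> //; rewrite derive1E'// (diff_comp dp dH) /= diff_pair//.
rewrite -(derive1E' da) -(derive1E' db).
set x := derive1 a t; set y := derive1 b t.
have -> : (x, y) = x *: (1, 0) + y *: (0, 1) :> R * R.
  rewrite [RHS]surjective_pairing /= /GRing.scale /=.
  by rewrite !mulr0 !mulr1 addr0 add0r.
by rewrite linearD !linearZ_LR.
Qed.

(** By the factorization h y - h x = g y (y - x) with g continuous and
    g x = h' x nonzero. *)
Lemma isolated_level (h : R -> R) x : differentiable h x -> derive1 h x != 0 ->
  \forall y \near x, h y = h x -> y = x.
Proof.
move=> dh h0; have /is_derive1_caratheodory[g [hE cg gx]] : is_derive x 1 h (derive1 h x).
  by rewrite derive1E; apply: derivableP; apply/derivable1_diffP.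
have : \forall y \near x, g y != 0.
  apply: (cg [set y | y != 0]); apply: open_nbhs_nbhs; split; first exact: open_neq.
  by rewrite /= gx.
apply: filterS => y gy hy; have := hE y; rewrite hy subrr => /esym/eqP.
by rewrite mulf_eq0 (negbTE gy)/= subr_eq0 => /eqP.
Qed.

End RealFunctions.

(** The graphs y = v x and x = u y meet: by the intermediate value theorem
    x - u (v x) vanishes somewhere, as it changes sign between a and b. *)
Lemma graphs_cross (R : realType) (a b : R) (u v : R -> R) :
  {within `[a, b], continuous v} ->
  (forall x, x \in `[a, b] -> {for v x, continuous u}) ->
  (forall x, x \in `[a, b] -> a <= u (v x) <= b) -> a <= b ->
  exists2 x, x \in `[a, b] & u (v x) = x.
Proof.
move=> cv cu uab ab.
have ca : a \in `[a, b] by rewrite in_itv /= lexx.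
have cb : b \in `[a, b] by rewrite in_itv /= lexx andbT.
have [||x xab ux] := @IVT R (fun x => x - u (v x)) a b 0 ab.
- apply/subspace_continuousP => x xab.
  apply: cvgB; first exact: cvg_within_filter.
  apply: (@cvg_comp _ _ _ v u _ (nbhs (v x))); last exact: cu.
  by move/subspace_continuousP : cv; exact.
- have /andP[ua _] := uab a ca; have /andP[_ ub] := uab b cb.
  by rewrite ge_min le_max !subr_le0 !subr_ge0 ua ub orbT.
by exists x => //; apply/esym/subr0_eq.
Qed.

(** * The bifurcation in the parameter plane *)

Lemma convex_comb_lt (R : realFieldType) (e t u v : R) : 0 <= t -> t <= 1 ->
  -e < u -> u < e -> -e < v -> v < e ->
  (-e < (1 - t) * u + t * v) && ((1 - t) * u + t * v < e).
Proof.
move=> t0 t1 u1 u2 v1 v2.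
have [->|tn0] := eqVneq t 0; first by rewrite subr0 mul1r mul0r addr0 u1.
have tp : 0 < t by rewrite lt0r tn0.
have H1 : 0 < t * (e - v) by rewrite mulr_gt0// subr_gt0.
have H2 : 0 < t * (e + v) by rewrite mulr_gt0//; lra.
have H3 : 0 <= (1 - t) * (e - u) by rewrite mulr_ge0//; lra.
have H4 : 0 <= (1 - t) * (e + u) by rewrite mulr_ge0//; lra.
apply/andP; split; nra.
Qed.

Section PlanarBifurcation.
Variables (R : realType) (P1 : set R) (G : R -> R -> R) (c : R -> R) (nus ps : R).

Let Gu (z : R * R) := G z.1 z.2.
Let Dp (z : R * R) := 'd Gu z (0, 1).
Let Dn (z : R * R) := 'd Gu z (1, 0).

Hypothesis G2 : Cr_near (Some 2%N) (nus, ps) Gu.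
Hypothesis P1ps : P1° ps.

Let did (x : R) : differentiable (@idfun R) x.
Proof. by []. Qed.

Let partial1 (H : R * R -> R) (a b : R) : differentiable H (a, b) ->
  derive1 (fun s => H (s, b)) a = 'd H (a, b) (1, 0).
Proof.
move=> dH; have [_ ->] := diff_along_curve (did a) (differentiable_cst b a) dH.
by rewrite derive1_cst mul0r addr0 derive1_id mul1r.
Qed.

Let partial2 (H : R * R -> R) (a b : R) : differentiable H (a, b) ->
  derive1 (fun s => H (a, s)) b = 'd H (a, b) (0, 1).
Proof.
move=> dH; have [_ ->] := diff_along_curve (differentiable_cst a b) (did b) dH.
by rewrite derive1_cst mul0r add0r derive1_id mul1r.
Qed.

Let near_regular : \forall z \near (nus, ps),
  [/\ P1° z.2, Cr_near (Some 2%N) z Gu & differentiable Gu z].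
Proof.
have H1 : \forall z \near (nus, ps), P1° z.2.
  apply: (@near_snd _ _ nus ps P1°); apply: open_nbhs_nbhs.
  by split=> //; exact: open_interior.
near=> z; have Gz : Cr_near (Some 2%N) z Gu by near: z; exact: (Cr_near_near G2).
split=> //; first by near: z.
exact: Cr_near_differentiable Gz.
Unshelve. all: by end_near. Qed.

Let dp1E z : P1° z.2 -> differentiable Gu z -> dp1 P1 G z.1 z.2 = Dp z.
Proof.
move=> Pz dG; rewrite /dp1 derive_withinE//.
by rewrite /Dp [in RHS](surjective_pairing z) -partial2 -?surjective_pairing.
Qed.

Let near_dp1 : \forall z \near (nus, ps), dp1 P1 G z.1 z.2 = Dp z.
Proof. by apply: filterS near_regular => z [Pz _ dG]; exact: dp1E. Qed.

Let dDp : differentiable Dp (nus, ps).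
Proof. exact: Cr_near_differentiable (Cr_near_diff _ G2). Qed.

Let dDn : differentiable Dn (nus, ps).
Proof. exact: Cr_near_differentiable (Cr_near_diff _ G2). Qed.

Lemma dp1_dp1E : dp1 P1 (dp1 P1 G) nus ps = 'd Dp (nus, ps) (0, 1).
Proof.
rewrite {1}/dp1 derive_withinE// -partial2//; apply: near_eq_derive1.
apply: (near_curve (P := fun z => dp1 P1 G z.1 z.2 = Dp z) (f := cst nus) (g := id)) => //.
exact: cst_continuous.
Qed.

Lemma dnu_dp1E : dnu (dp1 P1 G) nus ps = 'd Dp (nus, ps) (1, 0).
Proof.
rewrite {1}/dnu -partial1//; apply: near_eq_derive1.
apply: (near_curve (P := fun z => dp1 P1 G z.1 z.2 = Dp z) (f := id) (g := cst ps)) => //.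
exact: cst_continuous.
Qed.

Lemma red_bif_fun_diag nu : red_bif_fun P1 G c nu (c nu) = dp1 P1 G nu (c nu).
Proof.
rewrite /red_bif_fun (_ : (fun _ => _) = fun=> dp1 P1 G nu (c nu)); last first.
  by apply/funext => t; rewrite subrr mulr0 add0r.
have m01 : (@lebesgue_measure R) `[0, 1]%classic = 1%E.
  by rewrite lebesgue_measure_itv /= lte_fin ltr01 oppr0 adde0.
by rewrite Rintegral_cst// [X in fine X]m01 mulr1.
Qed.

Hypothesis dc : differentiable c nus.
Hypothesis cnus : c nus = ps.
Hypothesis Gc : \forall nu \near nus, G nu (c nu) = 0.

(** The segment between the point and the graph of c stays in a ball around
    (nus, ps), where G is C^1 and vanishes on that graph. *)
Lemma reduction_near : \forall z \near (nus, ps),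
  G z.1 z.2 = (z.2 - c z.1) * red_bif_fun P1 G c z.1 z.2.
Proof.
have /nbhs_ballP[e e0 He] := near_regular.
have Gc' : \forall z \near (nus, ps), G z.1 (c z.1) = 0 /\ ball ps e (c z.1).
  apply: (@near_fst _ _ nus ps (fun x => G x (c x) = 0 /\ ball ps e (c x))).
  apply: filterI => //.
  have := differentiable_continuous dc; rewrite /prop_for/continuous_at cnus.
  by apply; exact: nbhsx_ballx.
near=> z.
have [Gz cz] : G z.1 (c z.1) = 0 /\ ball ps e (c z.1) by near: z.
have [z1 z2] : ball (nus, ps) e z by near: z; exact: nbhsx_ballx.
rewrite /red_bif_fun integral_derive_segment ?Gz ?subr0// => t.
rewrite in_itv /= => /andP[t0 t1]; set x := t * (z.2 - c z.1) + c z.1.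
have xe : ball ps e x.
  move: cz z2; rewrite /ball /= !ltr_norml => /andP[c1 c2] /andP[d1 d2].
  have -> : ps - x = (1 - t) * (ps - c z.1) + t * (ps - z.2) by rewrite /x; ring.
  exact: convex_comb_lt.
have [Px Gx dGx] : [/\ P1° x, Cr_near (Some 2%N) (z.1, x) Gu & differentiable Gu (z.1, x)].
  by have := He (z.1, x) (conj z1 xe).
split=> //; split.
  apply/derivable1_diffP.
  by have [] := diff_along_curve (differentiable_cst z.1 x) (did x) dGx.
have nearx : \forall y \near x, Dp (z.1, y) = derive1 (G z.1) y.
  have : \forall y \near x, ball ps e y.
    by apply: open_nbhs_nbhs; split=> //; exact: ball_open.
  apply: filterS => y ye; have [_ _ dGy] := He (z.1, y) (conj z1 ye).
  by rewrite /Dp -partial2.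
have cDp : {for x, continuous (fun y => Dp (z.1, y))}.
  have dDx : differentiable Dp (z.1, x) := Cr_near_differentiable (Cr_near_diff _ Gx).
  apply: differentiable_continuous.
  by have [] := diff_along_curve (differentiable_cst z.1 x) (did x) dDx.
move: cDp; rewrite /prop_for /continuous_at (nbhs_singleton nearx) => cDp.
by apply: cvg_trans cDp; exact: near_eq_cvg.
Unshelve. all: by end_near. Qed.

(** By the chain rule the quantity assumed to be nonzero is the derivative at nus
    of nu |-> dG/dp1 (nu, c nu). *)
Lemma isolated_crossing : dp1 P1 G nus ps = 0 ->
  dnu (dp1 P1 G) nus ps + dp1 P1 (dp1 P1 G) nus ps * derive1 c nus != 0 ->
  \forall nu \near nus, dp1 P1 G nu (c nu) = 0 -> nu = nus.
Proof.
move=> h0; rewrite dp1_dp1E dnu_dp1E => h1.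
have dDc : differentiable Dp (nus, c nus) by rewrite cnus.
have [dh hE] := diff_along_curve (did nus) dc dDc.
have : derive1 (fun s => Dp (s, c s)) nus != 0.
  by rewrite hE cnus derive1_id mul1r mulrC.
move=> /(isolated_level dh); apply: filterS2; last first.
  apply: (near_curve (f := id) (@cvg_id _ _) (differentiable_continuous dc)).
  by rewrite cnus; exact: near_dp1.
move=> nu /= hnu H hc; apply: H; rewrite -hnu hc cnus.
by rewrite -[Dp _](nbhs_singleton near_dp1).
Qed.

(** The p-derivative of G is assumed to vanish at (nus, ps), and so does the
    derivative along the graph of c, hence the whole gradient. With m p the
    derivative of p |-> G (phi p) p, which is zero near ps, phi' = 0 at ps would
    reduce the derivative of m there to the second derivative of G in p. *)
Lemma derive_branch_neq0 (phi : R -> R) : Cr_near (Some 2%N) ps phi ->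
  phi ps = nus -> (\forall p \near ps, G (phi p) p = 0) ->
  dp1 P1 G nus ps = 0 -> dp1 P1 (dp1 P1 G) nus ps != 0 -> derive1 phi ps != 0.
Proof.
move=> Cphi phis Gphi h0 h1; apply/negP => /eqP phi'0.
have dphi := Cr_near_differentiable Cphi.
have dphi' : differentiable (fun p => 'd phi p 1) ps.
  exact: Cr_near_differentiable (Cr_near_diff _ Cphi).
have Dps : Dp (nus, ps) = 0 by rewrite -(nbhs_singleton near_dp1).
have dGs : differentiable Gu (nus, ps) by have [] := nbhs_singleton near_regular.
(* The derivative of G along the graph of c is zero, and so is its p-part. *)
have Dns : Dn (nus, ps) = 0.
  have dGc : differentiable Gu (nus, c nus) by rewrite cnus.
  have [_] := diff_along_curve (did nus) dc dGc; rewrite cnus.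
  rewrite -/(Dn _) -/(Dp _) Dps mulr0 addr0 derive1_id mul1r => <-.
  by rewrite -(derive1_cst (0 : R) nus); exact: near_eq_derive1.
pose m p := 'd phi p 1 * Dn (phi p, p) + Dp (phi p, p).
have near_m : \forall p \near ps, m p = 0.
  have nearG : \forall p \near ps, \forall q \near p, G (phi q) q = 0 by exact: near_join.
  have nearR : \forall p \near ps, differentiable Gu (phi p, p).
    apply: (@near_curve _ _ _ phi id ps (fun z => differentiable Gu z)) => //.
      exact: differentiable_continuous.
    by rewrite phis; apply: filterS near_regular => z [].
  have nearP : \forall p \near ps, differentiable phi p.
    apply: filterS (Cr_near_near Cphi) => p; exact: Cr_near_differentiable.
  near=> p.
  have dphip : differentiable phi p by near: p.
  have dGp : differentiable Gu (phi p, idfun p) by near: p.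
  have [_] := diff_along_curve dphip (did p) dGp.
  rewrite derive1_id mul1r (derive1E' dphip) -/(m p) => <-.
  rewrite -(derive1_cst (0 : R) p); apply: near_eq_derive1.
  by near: p.
have dDnp : differentiable Dn (phi ps, idfun ps) by rewrite phis.
have dDpp : differentiable Dp (phi ps, idfun ps) by rewrite phis.
have [dn _] := diff_along_curve dphi (did ps) dDnp.
have [dp dpE] := diff_along_curve dphi (did ps) dDpp.
have [ds dsE] := is_diff_scale dphi' dn.
have dsE' : is_derive ps 1 (fun p => 'd phi p 1 *: Dn (phi p, p)) 0.
  split; first by apply: diff_derivable; exact: ds.
  have a0 : 'd phi ps 1 = 0 by rewrite -(derive1E' dphi).
  have w0 : Dn (phi ps, idfun ps) = 0 by rewrite phis.
  rewrite (deriveE _ ds) dsE.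
  transitivity (0 *: 'd (fun p => Dn (phi p, idfun p)) ps 1 +
                'd (fun p => 'd phi p 1) ps 1 *: (0 : R)).
    by congr (_ *: _ + _ *: _).
  by rewrite scale0r scaler0 addr0.
have dpE' : is_derive ps 1 (fun p => Dp (phi p, p)) ('d Dp (nus, ps) (0, 1)).
  split; first by apply: diff_derivable; exact: dp.
  by rewrite -derive1E dpE phi'0 mul0r add0r derive1_id mul1r phis.
have dm := is_deriveD dsE' dpE'.
have m'0 : derive1 m ps = 0 by rewrite -(derive1_cst (0 : R) ps); exact: near_eq_derive1.
have Dpp : 'd Dp (nus, ps) (0, 1) = 0.
  have mE : 'D_1 m ps = 0 + 'd Dp (nus, ps) (0, 1) by case: dm.
  by move: m'0; rewrite derive1E mE add0r.
by move: h1; rewrite dp1_dp1E Dpp eqxx.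
Unshelve. all: by end_near. Qed.

End PlanarBifurcation.

(** The second branch is p = beta nu with beta the local inverse of phi. The
    conclusion is stated on balls around (phi ps, ps), the form in which the
    bifurcation is read off. *)
Lemma planar_touch_and_go (R : realType) (r : option nat) (J P1 : set R)
    (a b : R) (G : R -> R -> R) (c phi : R -> R) :
  class_le (Some 2%N) r -> open J -> J !=set0 -> P1 = `[a, b]%classic ->
  (forall nu, J nu -> P1° (c nu)) ->
  (forall nu, J nu -> Cr_near r nu c) ->
  (forall nu p, J nu -> P1° p ->
     Cr_near (Some 2%N) (nu, p) (fun z : R * R => G z.1 z.2)) ->
  (forall nu, J nu -> G nu (c nu) = 0) ->
  Cr_on r P1 phi -> (forall p, P1 p -> J (phi p)) ->
  (forall nu p, J nu -> P1 p -> red_bif_fun P1 G c nu p = 0 <-> nu = phi p) ->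
  (forall nu p, J nu -> P1 p -> dp1 P1 (dp1 P1 G) nu p != 0) ->
  (forall nu p, J nu -> P1 p ->
     dnu (dp1 P1 G) nu p + dp1 P1 (dp1 P1 G) nu p * derive1 c nu != 0) ->
  exists (ps : R) (beta : R -> R) (d e : R),
    [/\ P1 ps, c (phi ps) = ps, beta (phi ps) = ps,
       [/\ 0 < d, 0 < e & forall p, ball ps d p -> P1° p] &
       forall nu, ball (phi ps) e nu ->
         [/\ J nu, ball ps d (c nu), ball ps d (beta nu) /\ Cr_near r nu beta,
            (forall p, ball ps d p -> G nu p = 0 <-> p = c nu \/ p = beta nu) &
            (c nu = beta nu -> nu = phi ps)]].
Proof.
move=> le2 Jopen [nu0 Jnu0] P1itv cP1 cs Gs Gc phis phiJ redP Gpp Gtot.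
have J_nbhs nu : J nu -> nbhs nu J by move=> Jnu; exact: open_nbhs_nbhs.
have P1_sub p : P1° p -> P1 p by exact: interior_subset.
have c_ab nu : J nu -> a < c nu < b.
  by move=> /cP1; rewrite P1itv interior_itv_bnd /= in_itv.
have P1E p : p \in `[a, b] <-> P1 p by rewrite P1itv.
have [ps /P1E Pps0 crossE] : exists2 p, p \in `[a, b] & c (phi p) = p.
  apply: graphs_cross.
  - by rewrite -P1itv; exact: Cr_on_continuous phis.
  - by move=> p /P1E/phiJ/cs; exact: Cr_near_continuous.
  - by move=> p /P1E/phiJ/c_ab/andP[/ltW-> /ltW->].
  - by have /andP[ac cb] := c_ab _ Jnu0; exact: ltW (lt_trans ac cb).
pose nus := phi ps; have Jnus : J nus by exact: phiJ.
have Pps : P1° ps by rewrite -crossE; exact: cP1.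
have G2 := Gs _ _ Jnus Pps.
have phi_r : Cr_near r ps phi := Cr_on_interior Pps phis.
have phi_2 : Cr_near (Some 2%N) ps phi := Cr_near_le le2 phi_r.
have h0 : dp1 P1 G nus ps = 0.
  have := red_bif_fun_diag P1 G c nus; rewrite crossE => <-.
  exact: (redP nus ps Jnus Pps0).2.
have dc : differentiable c nus.
  exact: Cr_near_differentiable (Cr_near_le le2 (cs _ Jnus)).
have near_Gc : \forall nu \near nus, G nu (c nu) = 0.
  by apply: filterS (J_nbhs _ Jnus) => nu /Gc.
have near_red := reduction_near G2 Pps dc crossE near_Gc.
have near_P1 : \forall p \near ps, P1° p.
  by apply: open_nbhs_nbhs; split=> //; exact: open_interior.
have near_Gphi : \forall p \near ps, G (phi p) p = 0.
  have := near_curve (f := phi) (g := id) (Cr_near_continuous phi_r) (@cvg_id _ _)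
    near_red.
  apply: filterS2 near_P1 => p Pp /= ->.
  by rewrite (redP (phi p) p _ (P1_sub _ Pp)).2 ?mulr0//; apply/phiJ/P1_sub.
have phi'0 := derive_branch_neq0 G2 Pps dc crossE near_Gc phi_2 erefl near_Gphi
  h0 (Gpp _ _ Jnus Pps0).
have [beta [betaK phiK beta_r]] := Cr_near_inverse (le2 1%N erefl) phi_r phi'0.
have beta_nus : beta nus = ps by exact: nbhs_singleton betaK.
have iso := isolated_crossing G2 Pps dc crossE h0 (Gtot _ _ Jnus Pps0).
have [d /= d0 Hd] : exists2 d : R, 0 < d & forall z, ball (nus, ps) d z ->
    [/\ J z.1, P1° z.2, beta (phi z.2) = z.2 &
        G z.1 z.2 = (z.2 - c z.1) * red_bif_fun P1 G c z.1 z.2].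
  apply/nbhs_ballP; apply: filterS3 near_red (near_fst ps (J_nbhs _ Jnus))
    (near_snd nus (filterI near_P1 betaK)).
  by move=> z /= Gz Jz [Pz bz].
have [e /= e0 He] : exists2 e : R, 0 < e & forall nu, ball nus e nu ->
    [/\ ball nus d nu, ball ps d (c nu), ball ps d (beta nu), phi (beta nu) = nu &
        Cr_near r nu beta /\ (dp1 P1 G nu (c nu) = 0 -> nu = nus)].
  apply/nbhs_ballP; near=> nu; split; last split.
  - near: nu; exact: nbhsx_ballx.
  - near: nu; have := differentiable_continuous dc.
    rewrite /prop_for /continuous_at crossE.
    by apply; exact: nbhsx_ballx.
  - near: nu; have := Cr_near_continuous beta_r; rewrite /prop_for /continuous_at.
    by apply; rewrite beta_nus; exact: nbhsx_ballx.
  - by near: nu.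
  - by near: nu; exact: Cr_near_near beta_r.
  - by near: nu.
exists ps, beta, d, e; split=> //.
  by split=> // p pd; have [_ + _ _] := Hd (nus, p) (conj (ballxx nus d0) pd).
move=> nu /He[nud cd bd phib [beta_s isonu]].
have [Jnu _ _ _] := Hd (nu, ps) (conj nud (ballxx ps d0)).
split=> //.
  move=> p pd; have [/= _ Pp bp ->] := Hd (nu, p) (conj nud pd).
  have redE := redP nu p Jnu (P1_sub _ Pp).
  split=> [/eqP|[->|pb]]; last 2 first.
  - by rewrite subrr mul0r.
  - by apply/eqP; rewrite mulf_eq0; apply/orP; right; apply/eqP/redE; rewrite pb phib.
  rewrite mulf_eq0 subr_eq0 => /orP[/eqP|/eqP/redE nuE]; [by left|right].
  by rewrite nuE bp.
move=> cb; apply: isonu; rewrite -red_bif_fun_diag.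
by apply/redP => //; [exact/P1_sub/cP1|rewrite cb].
Unshelve. all: by end_near. Qed.

(** * Smooth maps into a manifold *)

Section ChartCalculus.
Variables (R : realType) (X : topologicalType) (E : normedModType R).
Variable A : set (chart X E).
Hypothesis hX : is_smooth_manifold A.
Hypothesis fE : finite_dimensional E.
Implicit Types (V W : normedModType R) (r : option nat) (c d : chart X E).

Let A_chart c : A c -> is_chart c.
Proof. by have [_ _ + _ _] := hX; exact. Qed.

Let A_cover (x : X) : exists2 c, A c & cdom c x.
Proof. by have [_ _ _ + _] := hX; exact. Qed.

Lemma cdom_nbhs c x : is_chart c -> cdom c x -> nbhs x (cdom c).
Proof. by move=> [oc _ _ _ _] cx; exact: open_nbhs_nbhs. Qed.

Lemma atlas_smooth_chart c : A c -> smooth_chart A c.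
Proof.
move=> Ac; split; first exact: A_chart.
by move=> c' Ac'; have [_ _ _ _ H] := hX; split; exact: H.
Qed.

Lemma Cr_near_transition r c d x : is_chart c -> is_chart d ->
  smooth_transition c d -> cdom c x -> cdom d x ->
  Cr_near r (cfun c x) (cfun d \o cinv c).
Proof.
move=> [oc oc' cK cc ci] dd cd cx dx.
exists (cfun c @` (cdom c `&` cdom d))°; split.
- exact: open_interior.
- have : {for cfun c x, continuous (cinv c)} by apply: ci; exists x.
  rewrite /prop_for /continuous_at cK// => /(_ _ (cdom_nbhs dd dx)) near_d.
  have near_c : nbhs (cfun c x) (cfun c @` cdom c).
    by apply: open_nbhs_nbhs; split=> //; exists x.
  have : \forall z \near cfun c x, cdom d (cinv c z) /\ (cfun c @` cdom c) z.
    by apply: filterI near_c; exact: near_d.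
  rewrite -nbhs_nearE; apply: filterS => z /= [dz [y cy yz]].
  by exists y => //; split=> //; move: dz; rewrite -yz cK.
- move=> j _; apply: (@Ck_sub _ _ _ _ (cfun c @` (cdom c `&` cdom d))).
    exact: interior_subset.
  exact: cd.
Qed.

(** One chart of the atlas suffices, by the smoothness of the transition maps
    ([smooth_at_chart]). *)
Definition smooth_at V r (z : V) (Y : V -> X) : Prop :=
  {for z, continuous Y} /\
  exists c, [/\ A c, cdom c (Y z) & Cr_near r z (cfun c \o Y)].

Lemma near_cdom V (z : V) (Y : V -> X) c : is_chart c ->
  {for z, continuous Y} -> cdom c (Y z) -> \forall w \near z, cdom c (Y w).
Proof. by move=> hc cY cYz; exact: (cY _ (cdom_nbhs hc cYz)). Qed.

Lemma Cr_near_change_chart V r (z : V) (Y : V -> X) c d :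
  is_chart c -> is_chart d -> smooth_transition c d ->
  {for z, continuous Y} -> cdom c (Y z) -> cdom d (Y z) ->
  Cr_near r z (cfun c \o Y) -> Cr_near r z (cfun d \o Y).
Proof.
move=> hc hd cd cY cYz dYz YC.
apply: (@Cr_near_eq _ _ _ _ _ ((cfun d \o cinv c) \o (cfun c \o Y))).
  apply: filterS (near_cdom hc cY cYz) => w cYw /=.
  by have [_ _ -> //] := hc.
by apply: Cr_near_comp => //; exact: Cr_near_transition.
Qed.

Lemma smooth_at_chart V r (z : V) (Y : V -> X) d : smooth_at r z Y ->
  smooth_chart A d -> cdom d (Y z) -> Cr_near r z (cfun d \o Y).
Proof.
move=> [cY [c [Ac cYz YC]]] [hd Ad] dYz.
have [_ cd] := Ad c Ac.
exact: (Cr_near_change_chart (A_chart Ac) hd cd cY cYz dYz YC).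
Qed.

Lemma smooth_at_of_chart V r (z : V) (Y : V -> X) d : smooth_chart A d ->
  cdom d (Y z) -> {for z, continuous Y} -> Cr_near r z (cfun d \o Y) ->
  smooth_at r z Y.
Proof.
move=> [hd Ad] dYz cY YC; split=> //; have [c Ac cYz] := A_cover (Y z).
exists c; split=> //; have [dc _] := Ad c Ac.
exact: (Cr_near_change_chart hd (A_chart Ac) dc cY dYz cYz YC).
Qed.

Lemma smooth_at_comp V W r (z : V) (h : V -> W) (Y : W -> X) :
  finite_dimensional W -> Cr_near r z h -> smooth_at r (h z) Y ->
  smooth_at r z (Y \o h).
Proof.
move=> fW hz [cY [c [Ac cYz YC]]]; split.
  by apply: continuous_comp => //; exact: Cr_near_continuous hz.
by exists c; split=> //; apply: (Cr_near_comp fW hz YC).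
Qed.

Lemma Cr_map_smooth_at V r (D : set V) (Y : V -> X) :
  Cr_map (id_atlas (E := V)) A r D Y <-> forall z, D z -> smooth_at r z Y.
Proof.
split=> [H z Dz|H z Dz].
  have [cY HY] := H z Dz; split=> //.
  have [d Ad dYz] := A_cover (Y z); exists d; split=> //.
  by have [B [oB Bz HB]] := HY (Chart setT id id) d erefl Ad I dYz; exists B.
split; first by have [] := H z Dz.
move=> c d -> Ad _ dYz.
exact: (smooth_at_chart (H z Dz) (atlas_smooth_chart Ad) dYz).
Qed.

Lemma smooth_at_family V r (M : set (R * X)) (g : R * X -> X)
    (nu : V -> R) (Y : V -> X) (z : V) :
  Cr_map (prod_atlas (id_atlas (E := R)) A) A r M g ->
  Cr_near r z nu -> smooth_at r z Y -> M (nu z, Y z) ->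
  smooth_at r z (fun w => g (nu w, Y w)).
Proof.
move=> Mg nuz [cY [c [Ac cYz YC]]] Mz; have [cg Hg] := Mg _ Mz; split.
  have cn : nu w @[w --> z] --> nu z := Cr_near_continuous nuz.
  have cp : (nu w, Y w) @[w --> z] --> (nbhs (nu z), nbhs (Y z)).
    exact: cvg_pair.
  exact: (cvg_comp _ g cp cg).
have [d Ad dz] := A_cover (g (nu z, Y z)); exists d; split=> //.
pose c0 := prod_chart (Chart setT id id : chart R R) c.
have Ac0 : prod_atlas (id_atlas (E := R)) A c0.
  by exists (Chart setT id id) => //; exists c.
have [B [oB Bz HB]] := Hg c0 d Ac0 Ad (conj I cYz) dz.
apply: (@Cr_near_eq _ _ _ _ _ ((cfun d \o g \o cinv c0) \o
    (fun w => (nu w, (cfun c \o Y) w)))).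
  apply: filterS (near_cdom (A_chart Ac) cY cYz) => w cYw /=.
  by have [_ _ -> //] := A_chart Ac.
apply: Cr_near_comp; last by exists B.
  exact: (finite_dimensional_prod (finite_dimensional_scalar R) fE).
exact: Cr_near_pair.
Qed.

Lemma smooth_at_iter V r (M : set (R * X)) (f : R -> X -> X)
    (nu : V -> R) (Y : V -> X) (z : V) (m : nat) :
  Cr_map (prod_atlas (id_atlas (E := R)) A) A r M (fun z => f z.1 z.2) ->
  Cr_near r z nu -> smooth_at r z Y -> iter_dom M f m (nu z, Y z) ->
  smooth_at r z (fun w => iter m (f (nu w)) (Y w)).
Proof.
move=> Mf nuz Yz; elim: m => [//|m IH] Dm.
apply: (smooth_at_family (g := fun z => f z.1 z.2) Mf nuz) => //=.
  by apply: IH => i im; apply: Dm; exact: ltnW.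
exact: (Dm m).
Qed.

Lemma smooth_at_le V r s (z : V) (Y : V -> X) :
  class_le s r -> smooth_at r z Y -> smooth_at s z Y.
Proof.
move=> sr [cY [c [Ac cYz YC]]]; split=> //; exists c; split=> //.
exact: Cr_near_le YC.
Qed.

End ChartCalculus.

Lemma Cr_map_le (R : realType) (X Y : topologicalType) (E F : normedModType R)
    (A : set (chart X E)) (B : set (chart Y F)) (r s : option nat)
    (D : set X) (g : X -> Y) :
  class_le s r -> Cr_map A B r D g -> Cr_map A B s D g.
Proof.
move=> sr Hg x Dx; have [cg H] := Hg x Dx; split=> // c d Ac Bd cx dx.
have [C [oC Cx HC]] := H c d Ac Bd cx dx; exists C; split=> // j /sr; exact: HC.
Qed.

(** Along an orbit that stays in the domain the iterates are jointly continuous,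
    so nearby orbits stay in it as well. *)
Lemma open_iter_dom (R : realType) (X : topologicalType) (M : set (R * X))
    (f : R -> X -> X) (m : nat) : open M ->
  (forall z, M z -> {for z, continuous (fun z : R * X => f z.1 z.2)}) ->
  open (iter_dom M f m).
Proof.
move=> oM cf; rewrite openE => z; rewrite /interior.
suff H : iter_dom M f m z -> nbhs z (iter_dom M f m) /\
    iter m (f y.1) y.2 @[y --> z] --> iter m (f z.1) z.2 by move=> /H[].
elim: m => [_|m IH Dm]; first by split; [exact: filterS filterT|exact: cvg_snd].
have [|nDm cm] := IH; first by move=> i im; apply: Dm; exact: ltnW.
have Mm : M (z.1, iter m (f z.1) z.2) by exact: (Dm m).
have cp : (y.1, iter m (f y.1) y.2) @[y --> z] -->
    (nbhs z.1, nbhs (iter m (f z.1) z.2)).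
  by apply: cvg_pair cm; exact: cvg_fst.
have nM : nbhs (z.1, iter m (f z.1) z.2) M by exact: open_nbhs_nbhs.
split; last exact: (cvg_comp _ (fun y : R * X => f y.1 y.2) cp (cf _ Mm)).
have near_M : \forall y \near z, M (y.1, iter m (f y.1) y.2) := cp _ nM.
apply: filterS2 nDm near_M => y Dy My i; rewrite ltnS leq_eqVlt => /predU1P[->//|].
exact: Dy.
Qed.

(** * Symmetric periodic points of reversible maps *)

Section Reversibility.
Variables (X : Type) (D : X -> Prop) (g : X -> X) (rho : X -> X).
Hypothesis g_inj : forall x y, D x -> D y -> g x = g y -> x = y.
Hypothesis rho_dom : forall x, D x -> D (rho (g x)).
Hypothesis rho_rev : forall x, D x -> g (rho (g x)) = rho x.

(** The innermost factor g rho g of g^m rho g^m collapses to rho. *)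
Lemma iter_reversing m x : (forall i, (i < m)%N -> D (iter i g x)) ->
  iter m g (rho (iter m g x)) = rho x.
Proof.
elim: m => [//|m IH] Dx; rewrite iterSr iterS rho_rev; last exact: Dx.
by apply: IH => i im; apply: Dx; exact: ltnW.
Qed.

Lemma iter_inj_on m x y : (forall i, (i < m)%N -> D (iter i g x)) ->
  (forall i, (i < m)%N -> D (iter i g y)) -> iter m g x = iter m g y -> x = y.
Proof.
elim: m => [//|m IH] Dx Dy gxy; apply: IH.
- by move=> i im; apply: Dx; exact: ltnW.
- by move=> i im; apply: Dy; exact: ltnW.
by apply: g_inj gxy; [exact: Dx|exact: Dy].
Qed.

(** As g^m rho g^m x = rho x = x, the equation g^m (g^m x) = x says that g^m takes
    the same value at g^m x and at rho (g^m x); now use injectivity. *)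
Lemma symmetric_fixed_pointP m x : rho x = x ->
  (forall i, (i < 2 * m)%N -> D (iter i g x)) ->
  iter (2 * m) g x = x <-> rho (iter m g x) = iter m g x.
Proof.
move=> rx Dx; rewrite mul2n -addnn iterD.
have Dm i : (i < m)%N -> D (iter i g x).
  by move=> im; apply: Dx; rewrite mul2n -addnn (leq_trans im)// leq_addr.
split=> [fx|h]; last by have := iter_reversing Dm; rewrite h rx.
apply: (@iter_inj_on m) => [i im|i im|]; last by rewrite iter_reversing// rx fx.
  have -> : iter m g x = iter i g (iter (m - i) g x) by rewrite -iterD subnKC// ltnW.
  rewrite iter_reversing; last first.
    move=> j ji; rewrite -iterD; apply: Dm.
    by move: im ji; lia.
  have -> : (m - i = (m - i).-1.+1)%N by rewrite prednK// subn_gt0.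
  apply: rho_dom; apply: Dm.
  by rewrite prednK ?subn_gt0// leq_subr.
rewrite -iterD; apply: Dx.
by rewrite mul2n -addnn ltn_add2r.
Qed.

Lemma iter_odd_2periodic k x : odd k -> iter 2 g x = x -> iter k g x = g x.
Proof.
move=> ok gx; rewrite -[k]odd_double_half ok add1n iterS -muln2; congr g.
by elim: (k./2) => [//|j IH]; rewrite mulSn addnC iterD gx.
Qed.

End Reversibility.

(** * The touch-and-go bifurcation *)

Theorem theorem8
  (R : realType)
  (* the class C^r, 2 <= r <= oo, meant by "smooth" *)
  (r : option nat) (hr : if r is Some m then (2 <= m)%N else true)
  (n : nat) (hn : (0 < n)%N)
  (* the manifold X of dimension 2n *)
  (X : topologicalType)
  (A : set (chart X (pqspace R n)))
  (hX : is_smooth_manifold A)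
  (* the C^3 family f *)
  (M : set (R * X)) (hM : open M) (f : R -> X -> X)
  (hf : Cr_map (prod_atlas (id_atlas (E := R)) A) A (Some 3%N) M
               (fun z => f z.1 z.2))
  (C1 : forall nu, slice_at M nu !=set0 ->
        diffeo_onto_image A A (Some 3%N) (slice_at M nu) (f nu))
  (* the reversing symmetry *)
  (rho rhoinv : X -> X)
  (rhoK : cancel rho rhoinv) (rhoinvK : cancel rhoinv rho)
  (rho_cont : continuous rho) (rhoinv_cont : continuous rhoinv)
  (rho_dom : forall nu x, slice_at M nu x -> slice_at M nu (rho (f nu x)))
  (rho_rev : forall nu x, slice_at M nu x ->
             rhoinv (f nu (rho (f nu x))) = x)
  (rho_fix : is_submanifold A [set x | rho x = x])
  (* the local setting *)
  (k : nat) (nuhat : R) (xhat : X) (hhat : M (nuhat, xhat))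
  (J : set R) (Jopen : open J) (Jitv : is_interval J) (Jhat : J nuhat)
  (U : set X) (Uopen : open U) (Uhat : U xhat)
  (hdom : forall nu x, J nu -> U x -> iter_dom M f (2 * k)%N (nu, x))
  (cU : chart X (pqspace R n))
  (cUsmooth : smooth_chart A cU) (cUdom : cdom cU = U)
  (cUfix : slice_chart [set x | rho x = x] cU)
  (cW : chart X (pqspace R n))
  (cWsmooth : smooth_chart A cW) (cWdom : cdom cW (f nuhat xhat))
  (cWfix : slice_chart [set x | rho x = x] cW)
  (* the curve of fixed points *)
  (xfp : R -> X) (p1c : R -> R) (p2c : R -> 'rV[R]_n.-1)
  (xfp_smooth : Cr_map (id_atlas (E := R)) A r J xfp)
  (xfpU : forall nu, J nu -> U (xfp nu))
  (xfp_coord : forall nu, J nu -> cfun cU (xfp nu) = pt (p1c nu) (p2c nu))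
  (xfp_fix : forall nu i, J nu -> (1 <= i <= k.-1)%N ->
     Fix_set (iter (2 * i)%N (f nu)) U (fun x => rho x = x) = [set xfp nu])
  (* (C2) *)
  (P1 : set R) (a b : R) (hP1 : P1 = `[a, b]%classic)
  (P2 : set 'rV[R]_n.-1) (hP2 : closed P2)
  (hPU : forall p1 p2, P1 p1 -> P2 p2 -> (cfun cU @` U) (pt p1 p2))
  (hPW : forall nu p1 p2, J nu -> P1 p1 -> P2 p2 ->
     cdom cW (iter k (f nu) (cinv cU (pt p1 p2))))
  (hp1c : forall nu, J nu -> (P1°) (p1c nu))
  (hp2c : forall nu, J nu -> P2 (p2c nu))
  (p2f : R -> R -> 'rV[R]_n.-1)
  (p2f_smooth : Cr_on r (J `*` P1) (fun z => p2f z.1 z.2))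
  (p2f_int : forall nu p1, J nu -> P1 p1 -> (P2°) (p2f nu p1))
  (C2 : forall nu p1 p2, J nu -> P1 p1 -> P2 p2 ->
     ((fk_coord cU cW f k nu p1 p2).2.2 = 0 <-> p2 = p2f nu p1))
  (* (C3) *)
  (nuf : R -> R) (nuf_smooth : Cr_on r P1 nuf)
  (nufJ : forall p1, P1 p1 -> J (nuf p1))
  (C3 : [set z | (J `*` P1) z /\
           red_bif_fun P1 (bif_fun cU cW f k p2f) p1c z.1 z.2 = 0]
        = [set (nuf p1, p1) | p1 in P1])
  (* (C4) *)
  (C4 : ~ [set u + v |
             u in [set dnu (dp1 P1 (bif_fun cU cW f k p2f)) z.1 z.2
                  | z in J `*` P1] &
             v in [set s * t |
                     s in [set dp1 P1 (dp1 P1 (bif_fun cU cW f k p2f)) z.1 z.2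
                          | z in J `*` P1] &
                     t in [set derive1 p1c nu | nu in J]]] 0)
  (hk1 : (1 < k)%N) (hkodd : odd k)
  (hGpp : ~ [set dp1 P1 (dp1 P1 (bif_fun cU cW f k p2f)) z.1 z.2
            | z in J `*` P1] 0) :
  exists (nus p1s : R) (p2s : 'rV[R]_n.-1),
    [/\ J nus, P1 p1s, P2 p2s &
        touch_and_go A r (iter_dom M f 2) (fun nu => iter 2 (f nu))
          (fun x => rho x = x) k nus (cinv cU (pt p1s p2s))].
Proof.
have J_nbhs nu : J nu -> nbhs nu J by move=> Jnu; exact: open_nbhs_nbhs.
have P1_sub p : P1° p -> P1 p by exact: interior_subset.
have P2_sub p : P2° p -> P2 p by exact: interior_subset.
have fRow : finite_dimensional 'rV[R]_n.-1 := finite_dimensional_row R n.-1.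
have fR := finite_dimensional_scalar R.
have fE' : finite_dimensional (R * 'rV[R]_n.-1)%type.
  exact: finite_dimensional_prod.
have fE : finite_dimensional (pqspace R n) by exact: finite_dimensional_prod.
have fRR : finite_dimensional (R * R)%type by exact: finite_dimensional_prod.
have hcU : is_chart cU by case: cUsmooth.
have cUK x : U x -> cinv cU (cfun cU x) = x.
  by rewrite -cUdom; case: hcU => _ _ + _ _; exact.
have cUcont x : U x -> {for x, continuous (cfun cU)}.
  by rewrite -cUdom; case: hcU => _ _ _ + _; exact.
have cUV z : (cfun cU @` U) z -> {for z, continuous (cinv cU)}.
  by rewrite -cUdom; case: hcU => _ _ _ _; exact.
have cU_img z : (cfun cU @` U) z -> U (cinv cU z) /\ cfun cU (cinv cU z) = z.
  by move=> [x Ux <-]; rewrite cUK.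
have k0 : (0 < k)%N by exact: ltnW.
have fix_pt x p1 p2 : U x -> cfun cU x = pt p1 p2 -> rho x = x.
  move=> Ux xE; have Ux' : cdom cU x by rewrite cUdom.
  by apply/(cUfix x Ux'); rewrite xE.
have symP m nu x : J nu -> U x -> rho x = x -> (m <= k)%N ->
    iter (2 * m) (f nu) x = x <-> rho (iter m (f nu) x) = iter m (f nu) x.
  move=> Jnu Ux rx mk; apply: (@symmetric_fixed_pointP _ (slice_at M nu)) => //.
  - move=> y z Dy Dz; have [_ _ [h [hK _]]] := C1 nu (ex_intro _ y Dy).
    by move=> /(congr1 h); rewrite !hK.
  - by move=> y /rho_dom.
  - by move=> y /rho_rev/(congr1 rho); rewrite rhoinvK.
  - by move=> i im; apply: (hdom _ _ Jnu Ux); rewrite (leq_trans im)// leq_mul2l.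
pose G := bif_fun cU cW f k p2f.
(* (C2) solves the q2-equation for p2, and the q1-equation is then G = 0. *)
have fixP nu p1 p2 : J nu -> P1 p1 -> P2 p2 ->
    iter (2 * k) (f nu) (cinv cU (pt p1 p2)) = cinv cU (pt p1 p2) <->
    p2 = p2f nu p1 /\ G nu p1 = 0.
  move=> Jnu Pp1 Pp2; have [Ux xE] := cU_img _ (hPU _ _ Pp1 Pp2).
  have rx := fix_pt _ _ _ Ux xE.
  rewrite (symP k) //; rewrite -(C2 _ _ _ Jnu Pp1 Pp2).
  have Wx := hPW _ _ _ Jnu Pp1 Pp2.
  have := cWfix _ Wx; rewrite /= => cWx.
  rewrite cWx /G /bif_fun; split.
    move=> H2; have H22 : (fk_coord cU cW f k nu p1 p2).2.2 = 0 by rewrite /fk_coord H2.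
    split=> //; have <- : p2 = p2f nu p1 by apply/C2.
    by rewrite /fk_coord H2.
  move=> [H22]; have -> : p2f nu p1 = p2 by apply/esym/C2.
  rewrite /fk_coord in H22 * => H1.
  by rewrite [LHS]surjective_pairing H1 H22.
(* On the curve the second iterate is the identity, so f^k acts as f, k being
   odd, and f maps the curve into Fix(R) by the criterion for m = 1. *)
have xfpE nu : J nu -> [/\ rho (xfp nu) = xfp nu,
    xfp nu = cinv cU (pt (p1c nu) (p2c nu)), p2c nu = p2f nu (p1c nu) &
    G nu (p1c nu) = 0].
  move=> Jnu; have Ux := xfpU _ Jnu.
  have xE : xfp nu = cinv cU (pt (p1c nu) (p2c nu)) by rewrite -xfp_coord// cUK.
  have rx := fix_pt _ _ _ Ux (xfp_coord _ Jnu).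
  have [] : p2c nu = p2f nu (p1c nu) /\ G nu (p1c nu) = 0; last by split.
  apply/fixP => //; [exact/P1_sub/hp1c|exact: hp2c|rewrite -xE].
  have k2 : (1 <= 1 <= k.-1)%N by case: (k) hk1 => [|[|m]].
  have [_ fx _] : Fix_set (iter (2 * 1) (f nu)) U (fun x => rho x = x) (xfp nu).
    by rewrite xfp_fix.
  rewrite (symP k) // (@iter_odd_2periodic _ _ _ _ hkodd fx).
  by apply/(symP 1%N nu (xfp nu) Jnu Ux rx k0).
have le2 : class_le (Some 2%N) r.
  by move=> j j2; move: hr; case: (r) => // m; exact: leq_trans.
have p1c_smooth nu : J nu -> Cr_near r nu p1c.
  move=> Jnu; have xs : smooth_at A r nu xfp.
    by have [H _] := Cr_map_smooth_at hX fE r J xfp; exact: H.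
  have xU : cdom cU (xfp nu) by rewrite cUdom; exact: xfpU.
  have xc := smooth_at_chart hX fE xs cUsmooth xU.
  have x1 := Cr_near_comp fE xc (Cr_near_fst _ _).
  apply: Cr_near_eq (Cr_near_comp fE' x1 (Cr_near_fst _ _)).
  by apply: filterS (J_nbhs _ Jnu) => nu' Jnu' /=; rewrite xfp_coord.
pose Y0 (z : R * R) := cinv cU (pt z.2 (p2f z.1 z.2)).
have JP nu p : J nu -> P1° p -> (J `*` P1)° (nu, p).
  move=> Jnu Pp; exists (J, P1) => //=; split=> //; exact: J_nbhs.
have Y0_smooth nu p : J nu -> P1° p -> smooth_at A r (nu, p) Y0.
  move=> Jnu Pp; have p2s := Cr_on_interior (JP _ _ Jnu Pp) p2f_smooth.
  have p2P : P2 (p2f nu p) by apply/P2_sub/p2f_int => //; exact: P1_sub.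
  have [Ux xE] := cU_img _ (hPU _ _ (P1_sub _ Pp) p2P).
  have y0s : Cr_near r (nu, p) (fun z : R * R => pt z.2 (p2f z.1 z.2)).
    apply: (@Cr_near_pair _ _ _ _ _ _ (fun z : R * R => (z.2, p2f z.1 z.2)) (fun=> 0)).
      by apply: Cr_near_pair p2s; exact: Cr_near_snd.
    exact: Cr_near_cst.
  apply: (smooth_at_of_chart hX fE cUsmooth); first by rewrite cUdom.
    have cy := Cr_near_continuous y0s.
    apply: (cvg_comp _ (cinv cU) cy).
    by apply: cUV; exists (Y0 (nu, p)).
  apply: Cr_near_eq y0s; rewrite -nbhs_nearE; apply: filterS (JP _ _ Jnu Pp).
  move=> [nu' p'] [/= Jnu' Pp'].
  have p2P' : P2 (p2f nu' p') by apply/P2_sub/p2f_int => //; exact: P1_sub.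
  by have [_ ->] := cU_img _ (hPU _ _ Pp' p2P').
have G_smooth nu p : J nu -> P1° p ->
    Cr_near (Some 2%N) (nu, p) (fun z : R * R => G z.1 z.2).
  move=> Jnu Pp.
  have p2P : P2 (p2f nu p) by apply/P2_sub/p2f_int => //; exact: P1_sub.
  have [Ux xE] := cU_img _ (hPU _ _ (P1_sub _ Pp) p2P).
  have f2 := Cr_map_le (s := Some 2%N) _ hf.
  have Yk : smooth_at A (Some 2%N) (nu, p) (fun z : R * R => iter k (f z.1) (Y0 z)).
    apply: (@smooth_at_iter _ _ _ _ hX fE _ _ M f fst).
    + by apply: f2 => j /= j2; exact: leqW.
    + exact: Cr_near_fst.
    + by apply: smooth_at_le (Y0_smooth _ _ Jnu Pp).
    + by move=> i ik; apply: (hdom _ _ Jnu Ux); rewrite (leq_trans ik)// leq_pmull.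
  have gs := smooth_at_chart hX fE Yk cWsmooth (hPW _ _ _ Jnu (P1_sub _ Pp) p2P).
  exact: (Cr_near_comp fE' (Cr_near_comp fE gs (Cr_near_snd _ _)) (Cr_near_fst _ _)).
have redP nu p : J nu -> P1 p -> red_bif_fun P1 G p1c nu p = 0 <-> nu = nuf p.
  move=> Jnu Pp; split=> [rz|nuE].
    have : [set (nuf p1, p1) | p1 in P1] (nu, p) by rewrite -C3; split.
    by move=> [p' _ [<- <-]].
  have : [set (nuf p1, p1) | p1 in P1] (nu, p) by exists p => //; rewrite nuE.
  by rewrite -C3 => -[].
have Gpp nu p : J nu -> P1 p -> dp1 P1 (dp1 P1 G) nu p != 0.
  by move=> Jnu Pp; apply/eqP => E; apply: hGpp; exists (nu, p).
have Gtot nu p : J nu -> P1 p ->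
    dnu (dp1 P1 G) nu p + dp1 P1 (dp1 P1 G) nu p * derive1 p1c nu != 0.
  move=> Jnu Pp; apply/eqP => E; apply: C4.
  exists (dnu (dp1 P1 G) nu p); first by exists (nu, p).
  exists (dp1 P1 (dp1 P1 G) nu p * derive1 p1c nu) => //.
  exists (dp1 P1 (dp1 P1 G) nu p); first by exists (nu, p).
  by exists (derive1 p1c nu) => //; exists nu.
have Gp1c nu : J nu -> G nu (p1c nu) = 0 by move=> /xfpE[].
have [ps [beta [d [e [Pps crossE beta_nus [d0 e0 Hd] He]]]]] :=
  planar_touch_and_go le2 Jopen (ex_intro _ nuhat Jhat) hP1 hp1c p1c_smooth
    G_smooth Gp1c nuf_smooth nufJ redP Gpp Gtot.
pose nus := nuf ps; have Jnus : J nus by exact: nufJ.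
have inI nu : `[nus - e / 2, nus + e / 2]%classic nu -> ball nus e nu.
  rewrite /= in_itv /= /ball /= ltr_norml => /andP[n1 n2].
  apply/andP; split; lra.
have IJ nu : ball nus e nu -> J nu /\ [/\ P1° (p1c nu), P1° (beta nu) &
    p2c nu = p2f nu (p1c nu)].
  move=> /He[Jnu _ [bd _] _ _].
  by split=> //; split; [exact: hp1c|exact: Hd|have [] := xfpE _ Jnu].
(* Over U' the p1-coordinate stays where the two branches are the only zeros of
   G, and p2 where (C2) applies; no bound is put on q, which vanishes on Fix(R). *)
pose U' : set X := [set x | [/\ U x, ball ps d (cfun cU x).1.1 & P2° (cfun cU x).1.2]].
pose xb nu := Y0 (nu, beta nu).
have U'_open : open U'.
  rewrite openE => x [Ux bx Px]; rewrite /interior.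
  have Ux_nbhs : nbhs x U by exact: open_nbhs_nbhs.
  have c1 : (cfun cU y).1 @[y --> x] --> nbhs (cfun cU x).1.
    by apply: (cvg_comp _ fst (cUcont x Ux)); exact: cvg_fst.
  have near_box : \forall z \near (cfun cU x).1, ball ps d z.1 /\ P2° z.2.
    rewrite [(cfun cU x).1]surjective_pairing.
    apply: filterI.
      by apply: near_fst; apply: open_nbhs_nbhs; split=> //; exact: ball_open.
    by apply: near_snd; apply: open_nbhs_nbhs; split=> //; exact: open_interior.
  have c2 : \forall y \near x, ball ps d (cfun cU y).1.1 /\ P2° (cfun cU y).1.2.
    exact: (c1 _ near_box).
  by apply: filterS2 Ux_nbhs c2 => y Uy [].
have xfpU' nu : ball nus e nu -> U' (xfp nu).
  move=> nue; have [Jnu [Pc Pb p2E]] := IJ _ nue; have [_ cd _ _ _] := He _ nue.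
  split; [exact: xfpU|by rewrite xfp_coord|rewrite xfp_coord//= p2E].
  by apply: p2f_int => //; exact: P1_sub.
have xb_coord nu : ball nus e nu ->
    U (xb nu) /\ cfun cU (xb nu) = pt (beta nu) (p2f nu (beta nu)).
  move=> nue; have [Jnu [_ Pb _]] := IJ _ nue; apply: cU_img; apply: hPU.
    exact: P1_sub.
  by apply/P2_sub/p2f_int => //; exact: P1_sub.
have xbU' nu : ball nus e nu -> U' (xb nu).
  move=> nue; have [Jnu [_ Pb _]] := IJ _ nue; have [_ _ [bd _] _ _] := He _ nue.
  have [Ux xE] := xb_coord _ nue; split=> //; rewrite xE //=.
  by apply: p2f_int => //; exact: P1_sub.
have xb_smooth nu : ball nus e nu -> smooth_at A r nu xb.
  move=> nue; have [Jnu [_ Pb _]] := IJ _ nue; have [_ _ [_ bs] _ _] := He _ nue.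
  apply: (smooth_at_comp fRR (h := fun nu => (nu, beta nu)) (Y := Y0)).
    by apply: Cr_near_pair bs; exact: Cr_near_id.
  exact: Y0_smooth.
have xfp_sm nu : ball nus e nu -> smooth_at A r nu xfp.
  move=> nue; have [Jnu _] := IJ _ nue.
  by have [H _] := Cr_map_smooth_at hX fE r J xfp; exact: H.
have curveP (Y : R -> X) : (forall nu, ball nus e nu -> U' (Y nu)) ->
    (forall nu, ball nus e nu -> smooth_at A r nu Y) ->
    let I := `[nus - e / 2, nus + e / 2]%classic in
    [/\ (forall nu, I nu -> (U'°) (Y nu)), {within I, continuous Y} &
        Cr_map (id_atlas (E := R)) A r `]nus - e / 2, nus + e / 2[ Y].
  move=> YU Ys I; split.
  - by move=> nu /inI/YU; move/interior_id : U'_open => ->.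
  - apply: continuous_in_subspaceT => nu; rewrite inE => /inI/Ys[].
    by [].
  - apply/(Cr_map_smooth_at hX fE) => nu nuI; apply/Ys/inI.
    exact: (subset_itv_oo_cc nuI).
have nus_e : ball nus e nus by exact: ballxx.
exists nus, ps, (p2f nus ps); split=> //.
  by apply/P2_sub/p2f_int.
have xfp_nus : xfp nus = cinv cU (pt ps (p2f nus ps)).
  by have [_ -> -> _] := xfpE _ Jnus; rewrite crossE.
have dom2 nu x : J nu -> U x -> iter_dom M f 2 (nu, x).
  move=> Jnu Ux i i2; apply: (hdom _ _ Jnu Ux); rewrite (leq_trans i2)//.
  by rewrite -{1}(muln1 2%N) leq_mul2l.
split.
- by apply: open_iter_dom => // z /hf[].
- by rewrite -xfp_nus; apply: dom2 => //; exact: xfpU.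
exists (nus - e / 2), (nus + e / 2), U', xfp, xb; split.
- split.
  + by move=> [nu x] [/= /inI/IJ[Jnu _] [Ux _ _]]; exact: dom2.
  + exists (`[nus - e / 2, nus + e / 2]%classic, U') => //=; split.
      apply/nbhs_ballP; exists (e / 2); first by rewrite /= divr_gt0.
      move=> y; rewrite /ball /= ltr_norml in_itv /= => /andP[y1 y2].
      apply/andP; split; lra.
    by apply: open_nbhs_nbhs; split=> //; rewrite -xfp_nus; exact: xfpU'.
  + move=> [nu x] [/= /inI/IJ[Jnu _] [Ux _ _]] i ik j j2 /=.
    rewrite -iterM -iterD; apply: (hdom _ _ Jnu Ux).
    by move: ik j2; lia.
- exact: curveP.
- exact: curveP.
- move=> nu /inI nue; have [Jnu [Pc Pb p2E]] := IJ _ nue.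
  have [_ cd [bd _] zeroP _] := He _ nue; split.
    move=> p /andP[p1 pk].
    have pk1 : (1 <= p <= k.-1)%N by rewrite p1 -ltnS prednK.
    rewrite -(xfp_fix nu p Jnu pk1) mulnC; apply/seteqP; split=> x [].
      by move=> [Ux _ _] fx rx; split=> //; rewrite iterM.
    move=> Ux fx rx; split=> //; last by rewrite -iterM.
    have -> : x = xfp nu.
      have : Fix_set (iter (2 * p) (f nu)) U (fun x => rho x = x) x.
        by split=> //; rewrite mulnC.
      by rewrite xfp_fix.
    exact: xfpU'.
  apply/seteqP; split=> x.
    move=> [[Ux xd xP]]; rewrite -iterM mulnC => fx rx.
    have Ux' : cdom cU x by rewrite cUdom.
    have xE : cfun cU x = pt (cfun cU x).1.1 (cfun cU x).1.2.
      have := (cUfix x Ux').1 rx.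
      by rewrite /pt -surjective_pairing => <-; rewrite -surjective_pairing.
    move: xE xd xP; set p := (cfun cU x).1.1; set q := (cfun cU x).1.2 => xE pd Pq.
    have Pp : P1° p by exact: Hd.
    have xK : x = cinv cU (pt p q) by rewrite -xE cUK.
    have [qE /(zeroP _ pd)] : q = p2f nu p /\ G nu p = 0.
      by apply/fixP => //; [exact: P1_sub|exact: P2_sub|rewrite -xK].
    have [_ xfpK p2cE _] := xfpE _ Jnu.
    case=> pE; [left|right]; rewrite xK qE pE.
      by rewrite xfpK p2cE.
    by [].
  have fix_zero p : P1° p -> G nu p = 0 ->
      iter k (iter 2 (f nu)) (cinv cU (pt p (p2f nu p))) = cinv cU (pt p (p2f nu p)).
    move=> Pp Gp; rewrite -iterM mulnC; apply/fixP => //; [exact: P1_sub|].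
    by apply/P2_sub/p2f_int => //; exact: P1_sub.
  have [rx xfpK p2cE _] := xfpE _ Jnu; case=> ->.
    split=> //; first exact: xfpU'.
    by rewrite xfpK p2cE; apply: fix_zero => //; apply/(zeroP _ cd); left.
  have [Ub xbE] := xb_coord _ nue.
  split; [exact: xbU'| |exact: fix_pt Ub xbE].
  by apply: fix_zero => //; apply/(zeroP _ bd); right.
split=> //; first by rewrite /xb /Y0 /= beta_nus.
move=> nu /inI nue xE; have [Jnu _ _ _] := He _ nue; apply.
have [_ xbE] := xb_coord _ nue.
by have := congr1 (cfun cU) xE; rewrite xbE xfp_coord// => -[].
Qed.
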